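(* Let $k\ge1$ and $a\ge 2$ be integers, $R=\mathbb{Z}/a\mathbb{Z}$, $\alpha\in(0,1/2]$, and let $G$ be any finite abelian group whose exponent divides $a$. Then there exist constants $K,c>0$ depending only on $k,\alpha,G,a$ such that for every $n\ge 1$, if $M_1,\dots,M_k$ are independent random matrices in $\mathrm{Mat}_n(R)$ with iid $\alpha$-balanced entries, then $$\Big|\mathbf{E}\big[\#\mathrm{Sur}(\mathrm{Cok}(M_1\cdots M_k),G)\big]-n_k(G)\Big|\le Ke^{-cn}.$$
   Context: For $\alpha\in(0,1/2]$, an $R$-valued random variable $\xi$ (with $R=\mathbb{Z}/a\mathbb{Z}$) is $\alpha$-balanced if for every prime $p\mid a$, $\max_{r\in\mathbb{Z}/p\mathbb{Z}}\mathbf{P}(\xi\equiv r\bmod p)\le 1-\alpha$. For $M\in\mathrm{Mat}_n(R)$, $\mathrm{Cok}(M)=R^n/MR^n$. $\mathrm{Sur}(A,B)$ is the set of surjective group homomorphisms $A\to B$. For a finite abelian group $G$, $n_k(G)$ is the number of sequences of nested subgroups $0=H_0\le H_1\le\cdots\le H_{k-1}\le H_k=G$. *)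

(* Defs.v *)
From HB Require Import structures.
From mathcomp Require Import all_boot all_order all_algebra all_fingroup all_solvable.
From mathcomp Require Import all_classical all_reals all_analysis.

Set Implicit Arguments.
Unset Strict Implicit.
Unset Printing Implicit Defensive.

Import Order.TTheory GRing.Theory Num.Theory.
Local Open Scope classical_set_scope.
Local Open Scope ring_scope.

Section FiniteGroups.
Local Open Scope group_scope.

(* Homomorphisms are represented by finite functions on the whole carrier type
   of A, normalised to be 1 outside A so that each one is counted once. *)
Definition Sur (aT rT : finGroupType) (A : {set aT}) (B : {set rT}) :
    {set {ffun aT -> rT}} :=
  [set f : {ffun aT -> rT} |
    [&& 1.-support f \subset A, morphic A f & f @: A == B]]%SET.

Definition nested_chains (gT : finGroupType) (k : nat) (G : {group gT}) :
    {set {ffun 'I_k.+1 -> {group gT}}} :=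
  [set H : {ffun 'I_k.+1 -> {group gT}} |
    [&& H ord0 == 1%G, H ord_max == G &
        [forall i : 'I_k.+1, forall j : 'I_k.+1, (i <= j)%N ==> (H i \subset H j)]]]%SET.

Definition n_chains (k : nat) (gT : finGroupType) (G : {group gT}) : nat :=
  #|nested_chains k G|.

End FiniteGroups.

Section Cokernel.
Variables (R : finNzRingType) (n : nat).
Implicit Type M : 'M[R]_n.

Definition colspace M : {set 'cV[R]_n} := [set M *m v | v in [set: 'cV[R]_n]]%SET.

Lemma colspace_group_set M : group_set (colspace M).
Proof.
apply/group_setP; split.
  by apply/imsetP; exists 0; rewrite ?inE // mulmx0.
move=> _ _ /imsetP[u _ ->] /imsetP[v _ ->].
by apply/imsetP; exists (u + v); rewrite ?inE // mulmxDr.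
Qed.

Canonical colspace_group M := group (colspace_group_set M).

Definition Cok M : {group coset_of (colspace M)} :=
  ([set: 'cV[R]_n]%SET / colspace M)%G.

End Cokernel.

Section Probability.
Context {d : measure_display} {T : measurableType d} {R : realType}.
Variable P : probability T R.

(* Random elements of E, where E carries the discrete sigma-algebra; E is finite
   in all uses. *)
Definition discrete_random (E : Type) (X : T -> E) : Prop :=
  forall A : set E, measurable (X @^-1` A).

Definition mutually_independent (I : finType) (E : Type) (X : I -> T -> E) :
    Prop :=
  forall (J : {set I}) (A : I -> set E),
    P [set w | forall i, i \in J -> A i (X i w)] =
    (\prod_(i in J) P (X i @^-1` A i))%E.

Definition identically_distributed (I E : Type) (X : I -> T -> E) : Prop :=
  forall (i j : I) (A : set E), P (X i @^-1` A) = P (X j @^-1` A).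

Definition balanced (a : nat) (alpha : R) (xi : T -> 'Z_a) : Prop :=
  forall p : nat, prime p -> (p %| a)%N ->
  forall r : 'I_p,
    (P [set w | (xi w : nat) = r %[mod p]] <= (1 - alpha)%:E)%E.

Definition entry (a n : nat) (M : T -> 'M['Z_a]_n) (ij : 'I_n * 'I_n) (w : T) :
  'Z_a := M w ij.1 ij.2.

Definition iid_balanced_entries (a n : nat) (alpha : R) (M : T -> 'M['Z_a]_n) :
    Prop :=
  [/\ mutually_independent (entry M),
      identically_distributed (entry M)
    & forall ij, balanced alpha (entry M ij)].

End Probability.

(* Main.v *)
(** Surjections [Cok(M_1 ... M_k) -> G] are the generating [n]-tuples [F] of [G]
    with [F M_1 ... M_k = 0], where a matrix acts on tuples on the right.  Given a
    tuple [F'] in a subgroup [U], the expected number of generating tuples [F] of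
    [U] with [F M_1 = F'] is [1 + O(exp(-cn))], uniformly in [F']; conditioning on
    [M_1] then turns the moment for [k + 1] factors into the sum over [H <= U] of the
    moments for [k] factors, which is the recursion defining [n_k].

    For the lifting estimate, attach to [F] a subgroup [H] containing all but
    [O(m)] of its entries and such that every proper subgroup of [H] misses many
    of these entries.  A block of at most [|H|] suitable entries already gives
    every element of [H] mass bounded below (a sumset that is not yet [H] grows
    when a new generator escapes its stabiliser), so [m] disjoint blocks bring the
    law of [F X] within [(1 - gamma)^m] of uniform on [H].  If [H = U], then
    [P(F M = F')] is close to [|U|^(-n)].  If [H < U], some entry is outside [H],
    which costs a factor [1 - alpha] per column, while by a Chernoff bound such
    tuples are too few to compensate. *)
Require Import Defs.
From HB Require Import structures.
From mathcomp Require Import all_boot all_order all_algebra all_fingroup all_solvable.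
From mathcomp Require Import all_classical all_reals all_analysis.
From mathcomp Require Import measurable_realfun.
From mathcomp Require Import ring lra zify.

Set Implicit Arguments.
Unset Strict Implicit.
Unset Printing Implicit Defensive.

Import Order.TTheory GRing.Theory Num.Theory.
Local Open Scope ring_scope.

(** * Convolution on a finite abelian group *)

Section FfunCons.
Variables (T : finType) (n : nat).

Definition fcons (x : T) (f : {ffun 'I_n -> T}) : {ffun 'I_n.+1 -> T} :=
  [ffun i => oapp f x (unlift ord0 i)].

Lemma fcons0 x f : fcons x f ord0 = x.
Proof. by rewrite ffunE unlift_none. Qed.

Lemma fconsS x f i : fcons x f (lift ord0 i) = f i.
Proof. by rewrite ffunE liftK. Qed.

(** Peels off one coordinate; it drives the induction over summands in [law_setT] and over matrix
    factors in [kill_weightS]. *)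
Lemma big_fcons (M : nmodType) (Phi : {ffun 'I_n.+1 -> T} -> M) :
  \sum_f Phi f = \sum_x \sum_f Phi (fcons x f).
Proof.
rewrite pair_big /= (reindex (fun p => fcons p.1 p.2)) //=.
exists (fun f : {ffun 'I_n.+1 -> T} => (f ord0, [ffun i => f (lift ord0 i)])).
  move=> [x f] _ /=; rewrite fcons0; congr (_, _).
  by apply/ffunP => i; rewrite ffunE fconsS.
move=> f _; apply/ffunP => i /=.
by case: (unliftP ord0 i) => [j|] ->; rewrite ?fcons0 ?fconsS ?ffunE.
Qed.

End FfunCons.

Section Convolution.
Variables (R : comNzRingType) (V : finZmodType).
Implicit Types f g h : {ffun V -> R}.

Definition conv f g : {ffun V -> R} := [ffun x => \sum_y f (x - y) * g y].

Definition point_mass (x : V) : {ffun V -> R} := [ffun y => (y == x)%:R].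

Lemma convC : commutative conv.
Proof.
move=> f g; apply/ffunP => x; rewrite !ffunE (reindex_inj (subrI x)) /=.
by apply: eq_bigr => y _; rewrite subKr mulrC.
Qed.

Lemma convA : associative conv.
Proof.
move=> f g h; apply/ffunP => x; rewrite !ffunE.
under eq_bigr => y _ do rewrite ffunE mulr_sumr.
rewrite exchange_big /=; apply: eq_bigr => z _.
rewrite ffunE mulr_suml (reindex_inj (addIr z)) /=.
by apply: eq_bigr => y _; rewrite addrK mulrA opprD addrA addrAC.
Qed.

Lemma conv0f : left_id (point_mass 0) conv.
Proof.
move=> f; apply/ffunP => x; rewrite !ffunE (bigD1 x) //= ffunE subrr eqxx mul1r.
rewrite big1 ?addr0 // => y /negPf nyx.
by rewrite ffunE subr_eq0 eq_sym nyx mul0r.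
Qed.

(** With [conv] a commutative monoid law, the law of a random sum is a big operator over a set of
    indices, and splitting the set splits the law. *)
HB.instance Definition _ :=
  Monoid.isComLaw.Build {ffun V -> R} (point_mass 0) conv convA convC conv0f.

Lemma sum_conv f g : \sum_x conv f g x = (\sum_x f x) * \sum_y g y.
Proof.
under eq_bigr => x _ do rewrite ffunE.
rewrite exchange_big /= mulr_sumr; apply: eq_bigr => y _.
rewrite -mulr_suml; congr (_ * _).
by rewrite [RHS](reindex_inj (addIr (- y))).
Qed.

End Convolution.

(** * Laws of random sums *)

Section Law.
Variables (R : realFieldType) (V : finZmodType) (a : nat).
Implicit Types (nu : 'Z_a -> R) (x y : V) (f g : {ffun V -> R}).

Definition push nu x : {ffun V -> R} := [ffun y => \sum_(r : 'Z_a | x *+ r == y) nu r].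

(* The law of [\sum_(i in B) F i *+ xi_i], for independent [xi_i] of laws [nu i]. *)
Definition law (n : nat) (nu : 'I_n -> 'Z_a -> R) (F : {ffun 'I_n -> V}) (B : {set 'I_n}) :=
  \big[@conv R V/point_mass R 0]_(i in B) push (nu i) (F i).

Definition is_dist f := (forall x, 0 <= f x) /\ \sum_x f x = 1.

Definition is_weight nu := (forall r, 0 <= nu r) /\ \sum_r nu r = 1.

Definition balanced_weight (alpha : R) nu :=
  is_weight nu /\ forall p r : nat, prime p -> (p %| a)%N ->
    \sum_(s : 'Z_a | s == r %[mod p]) nu s <= 1 - alpha.

Lemma conv_push f nu x y : conv f (push nu x) y = \sum_(r : 'Z_a) f (y - x *+ r) * nu r.
Proof.
rewrite ffunE [RHS](partition_big (fun r : 'Z_a => x *+ r) predT) //=.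
apply: eq_bigr => z _; rewrite ffunE mulr_sumr.
by apply: eq_bigr => r /eqP->.
Qed.

Lemma dist_point_mass x : is_dist (point_mass R x).
Proof.
split=> [y|]; first by rewrite ffunE ler0n.
rewrite (bigD1 x) //= ffunE eqxx big1 ?addr0 // => y /negPf.
by rewrite ffunE => ->.
Qed.

Lemma dist_conv f g : is_dist f -> is_dist g -> is_dist (conv f g).
Proof.
move=> [f0 f1] [g0 g1]; split=> [x|]; last by rewrite sum_conv f1 g1 mul1r.
by rewrite ffunE sumr_ge0 // => y _; rewrite mulr_ge0.
Qed.

Lemma dist_push nu x : is_weight nu -> is_dist (push nu x).
Proof.
move=> [nu0 nu1]; split=> [y|]; first by rewrite ffunE sumr_ge0.
rewrite -nu1 [RHS](partition_big (fun r : 'Z_a => x *+ r) predT) //=.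
by apply: eq_bigr => y _; rewrite ffunE.
Qed.

Lemma dist_law n (nu : 'I_n -> 'Z_a -> R) F B :
  (forall i, is_weight (nu i)) -> is_dist (law nu F B).
Proof.
move=> nuP; apply: (big_ind is_dist); first exact: dist_point_mass.
  exact: dist_conv.
by move=> i _; apply: dist_push.
Qed.

Lemma dist_le1 f x : is_dist f -> f x <= 1.
Proof.
by move=> [f0 <-]; rewrite (bigD1 x) //= lerDl sumr_ge0.
Qed.

Lemma law_split n (nu : 'I_n -> 'Z_a -> R) F (B C : {set 'I_n}) : C \subset B ->
  law nu F B = conv (law nu F (B :\: C)) (law nu F C).
Proof.
move=> sCB; rewrite /law (big_setID C) /= (finset.setIidPr sCB); exact: convC.
Qed.

Lemma law_setU1 n (nu : 'I_n -> 'Z_a -> R) F i (B : {set 'I_n}) : i \notin B ->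
  law nu F (i |: B) = conv (law nu F B) (push (nu i) (F i)).
Proof. by move=> iB; rewrite /law big_setU1 //=; apply: convC. Qed.

(** Turns the convolution into a sum over all outcomes of the coefficients, the form in which the
    columns of a random matrix appear. *)
Lemma law_setT n (nu : 'I_n -> 'Z_a -> R) F y :
  law nu F [set: 'I_n] y =
  \sum_(v : {ffun 'I_n -> 'Z_a} | \sum_i F i *+ v i == y) \prod_i nu i (v i).
Proof.
rewrite /law (eq_bigl predT) => [|i]; last by rewrite inE.
elim: n nu F y => [|n IH] nu F y.
  rewrite big_ord0 ffunE eq_sym big_mkcond (big_pred1 [ffun=> 0]) => [|v].
    by rewrite !big_ord0; case: eqP.
  by apply/esym/eqP/ffunP; case.
rewrite big_ord_recl convC.
have -> : \big[@conv R V/point_mass R 0]_(i < n) push (nu (lift ord0 i)) (F (lift ord0 i)) =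
    \big[@conv R V/point_mass R 0]_(i < n) push (nu (lift ord0 i)) ([ffun i => F (lift ord0 i)] i).
  by apply: eq_bigr => i _; rewrite ffunE.
rewrite conv_push [RHS]big_mkcond big_fcons /=; apply: eq_bigr => r _.
rewrite (IH (fun i => nu (lift ord0 i))) mulr_suml big_mkcond; apply: eq_bigr => v _.
rewrite !big_ord_recl fcons0.
under [X in _ = if _ + X == _ then _ else _]eq_bigr => i _ do rewrite fconsS.
under [X in _ = if _ then _ * X else _]eq_bigr => i _ do rewrite fconsS.
rewrite eq_sym subr_eq addrC eq_sym.
rewrite mulrC (eq_bigr (fun i => F (lift ord0 i) *+ v i)) // => i _.
by rewrite ffunE.
Qed.

End Law.

(** * Mixing of random sums *)

Section Subgroups.
Variable V : finZmodType.
Implicit Types (H : {group V}) (x y : V).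

Lemma group_add H x y : x \in H -> y \in H -> x + y \in H.
Proof. exact: groupM. Qed.

Lemma group_opp H x : (- x \in H) = (x \in H).
Proof. exact: groupV. Qed.

Lemma group_sub H x y : x \in H -> y \in H -> x - y \in H.
Proof. by move=> Hx Hy; apply: group_add; rewrite ?group_opp. Qed.

Lemma group_mulrn H x m : x \in H -> x *+ m \in H.
Proof. by rewrite -FinRing.zmodXgE; apply: groupX. Qed.

Lemma group_addl H x y : x \in H -> (x + y \in H) = (y \in H).
Proof. exact: groupMl. Qed.

(** The order d of [x] modulo [H] exceeds 1 and divides [a], and x *+ r - x *+ s lies in [H] only if
    d divides r - s; any prime factor of d serves. *)
Lemma separating_prime (a : nat) H x : (forall y, y *+ a = 0) -> x \notin H ->
  exists p, [/\ prime p, (p %| a)%N &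
    forall r s : nat, x *+ r - x *+ s \in H -> r == s %[mod p]].
Proof.
move=> Va Hx.
have nHx : x \in 'N(H)%g.
  by apply/(fintype.subsetP (cent_sub H))/centP => y _; apply: FinRing.zmod_mulgC.
have dvdP m : (#[coset H x]%g %| m)%N = (x *+ m \in H).
  rewrite order_dvdn -morphX // FinRing.zmodXgE.
  apply/eqP/idP => [/coset_idr|/coset_id//]; apply.
  by rewrite -FinRing.zmodXgE groupX.
set d := #[coset H x]%g in dvdP.
have d1 : (1 < d)%N.
  rewrite ltn_neqAle order_gt0 andbT; apply: contraNneq Hx => d1.
  by rewrite -[x]mulr1n -dvdP -d1.
exists (pdiv d); split; first exact: pdiv_prime.
  by apply: dvdn_trans (pdiv_dvd d) _; rewrite dvdP Va group1.
have wl r s : (s <= r)%N -> x *+ r - x *+ s \in H -> r == s %[mod pdiv d].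
  move=> sr; rewrite -mulrnBr // -dvdP eqn_mod_dvd // => /(dvdn_trans _); apply.
  exact: pdiv_dvd.
move=> r s; have [sr|/ltnW rs] := leqP s r; first exact: wl.
by rewrite -group_opp opprB eq_sym; apply: wl.
Qed.

End Subgroups.

(** * Convergence of random sums to the uniform law on a subgroup *)

Section Mixing.
Variables (R : realFieldType) (V : finZmodType) (a : nat) (alpha : R).
Hypotheses (a_gt1 : (1 < a)%N) (Va : forall x : V, x *+ a = 0).
Hypotheses (alpha_gt0 : 0 < alpha) (alpha_le1 : alpha <= 1).
Variables (n : nat) (nu : 'I_n -> 'Z_a -> R) (F : {ffun 'I_n -> V}).
Hypothesis nuP : forall i, balanced_weight alpha (nu i).
Implicit Types (H : {group V}) (B I : {set 'I_n}) (x y : V).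

Let nuW i : is_weight (nu i). Proof. by case: (nuP i). Qed.

(** Chosen so that the values of smaller mass, at most [a] of them, weigh at most alpha / 2
    together. *)
Definition atom_mass : R := alpha / (a%:R *+ 2).

Let a_gt0 : 0 < a%:R :> R. Proof. by rewrite ltr0n ltnW. Qed.

Let beta_gt0 : 0 < atom_mass.
Proof. by rewrite divr_gt0 // pmulrn_lgt0. Qed.

Let beta_le1 : atom_mass <= 1.
Proof.
have a1 : 1 <= a%:R :> R by rewrite ler1n ltnW.
rewrite /atom_mass ler_pdivrMr; first by move: a1 alpha_le1; rewrite mul1r => *; lra.
by rewrite pmulrn_lgt0.
Qed.

(** Otherwise all heavy values would be congruent modulo a separating prime and weigh at most 1 -
    alpha; the light ones add at most alpha / 2, leaving the total mass below 1. *)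
Lemma balanced_atoms i H x : x \notin H ->
  exists r s : 'Z_a, [/\ atom_mass <= nu i r, atom_mass <= nu i s & x *+ r - x *+ s \notin H].
Proof.
move=> Hx; have [p [p_pr p_a sepP]] := separating_prime Va Hx.
case: (nuP i) => -[nu0 nu1] /(_ p _ p_pr p_a) nu_p.
pose T := [pred r : 'Z_a | atom_mass <= nu i r].
have [[r s] /and3P[rT sT rs]|none] :=
    pickP (fun q : 'Z_a * 'Z_a => [&& T q.1, T q.2 & x *+ q.1 - x *+ q.2 \notin H]).
  by exists r, s.
have le1 : \sum_(r | ~~ T r) nu i r <= alpha / 2.
  apply: le_trans (_ : \sum_(r : 'Z_a) atom_mass <= _).
    rewrite big_mkcond; apply: ler_sum => r _; case: ifP => [|_]; last exact: ltW.
    by rewrite /= -ltNge => /ltW.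
  rewrite sumr_const card_ord Zp_cast // /atom_mass -mulr_natr.
  have a0 : a%:R != 0 :> R by rewrite gt_eqF.
  rewrite le_eqVlt; apply/orP; left; apply/eqP; field.
  by rewrite a0.
have : \sum_(r | T r) nu i r <= 1 - alpha.
  have [r0 r0T|T0] := pickP T; last by rewrite big_pred0 ?subr_ge0.
  apply: le_trans (nu_p r0); rewrite big_mkcond [leRHS]big_mkcond.
  apply: ler_sum => r _; case: ifP => rT; last by case: ifP.
  case: ifP => // /negP[]; apply: sepP.
  by apply: contraFT (none (r, r0)) => rs; apply/and3P.
move: nu1; rewrite (bigID T) /= => nu1 leT; move: nu1 leT le1 alpha_gt0 => /=.
set A := \sum_(_ | _) _; set C := \sum_(_ | _) _; move=> *; exfalso; lra.
Qed.

(** Once the other summands are fixed, landing in the coset of [g] determines the coefficient of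
    [F i] modulo a separating prime, an event of probability at most 1 - alpha. *)
Lemma law_coset_le H B i g : i \in B -> F i \notin H ->
  \sum_(y | y - g \in H) law nu F B y <= 1 - alpha.
Proof.
move=> iB Hi; have [p [p_pr p_a sepP]] := separating_prime Va Hi.
have [nu0 nu1] := nuW i.
rewrite -(finset.setD1K iB) law_setU1 ?inE ?eqxx //.
set f := law _ _ _; have [f0 f1] : is_dist f by apply: dist_law.
under eq_bigr => y _ do rewrite convC ffunE.
rewrite exchange_big /= -[leRHS]mul1r -[X in X * _]f1 mulr_suml; apply: ler_sum => z _.
rewrite -mulr_suml mulrC; apply: ler_wpM2l => //.
rewrite (reindex_inj (addIr z)) /=.
under eq_bigr => y _ do rewrite addrK ffunE.
rewrite (exchange_big_dep predT) //=.
under eq_bigr => r _ do (rewrite (eq_bigl (fun y => (F i *+ r == y) && (F i *+ r + z - g \in H)));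
  last by move=> y; rewrite andbC; case: eqP => [->|]).
pose T := [pred r : 'Z_a | F i *+ r + z - g \in H].
rewrite (bigID T) /= [X in _ + X]big1 ?addr0; last first.
  by move=> r /negPf rT; rewrite big_pred0 // => y; rewrite rT andbF.
have [r0 r0T|T0] := pickP T; last by rewrite (eq_bigl _ _ T0) big_pred0_eq subr_ge0.
apply: le_trans (_ : \sum_(s : 'Z_a | s == r0 %[mod p]) nu i s <= _); last first.
  by case: (nuP i) => _ /(_ p r0 p_pr p_a).
rewrite big_mkcond [leRHS]big_mkcond; apply: ler_sum => r _ /=.
case: ifP => rT; last by case: ifP.
rewrite (big_pred1 (F i *+ r)); last by move=> y; rewrite rT andbT eq_sym.
case: ifP => // /negP[]; apply: sepP.
have := group_sub rT r0T; congr (_ \in H).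
by rewrite -[_ *+ r + z - g]addrA -[_ *+ r0 + z - g]addrA opprD addrACA subrr addr0.
Qed.

Lemma law_out H B y : (forall i, i \in B -> F i \in H) -> y \notin H ->
  law nu F B y = 0.
Proof.
move=> BH; pose supp (f : {ffun V -> R}) := forall y, y \notin H -> f y = 0 :> R.
suff: supp (law nu F B) by apply.
rewrite /law; apply: (big_ind supp).
- by move=> z; rewrite ffunE; case: eqP => // -> /negP[]; apply: group1.
- move=> f g Hf Hg z Hz; rewrite ffunE big1 // => t _.
  have [Ht|Ht] := boolP (t \in H); last by rewrite (Hg t) // mulr0.
  by rewrite Hf ?mul0r //; apply: contra Hz => Hzt; rewrite -(subrK t z) group_add.
- move=> i Bi z Hz; rewrite ffunE big_pred0 // => r.
  by apply: contraNF Hz => /eqP<-; apply: group_mulrn; apply: BH.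
Qed.

(* Sumset growth: as long as the reached set [S] is not all of [H], its
   stabiliser is a proper subgroup, so some unused [F i] escapes it and two atoms
   of [nu i] move [S] to two different translates. *)
Lemma law_support_growth H I m :
  (forall i, i \in I -> F i \in H) ->
  (forall K : {group V}, K \proper H -> #|H| <= #|[set i in I | F i \notin K]|)%N ->
  (0 < m <= #|H|)%N ->
  exists B (S : {set V}), [/\ B \subset I, S \subset H, (#|B| < m <= #|S|)%N &
    forall s, s \in S -> atom_mass ^+ #|B| <= law nu F B s].
Proof.
move=> IH escape; elim: m => // -[_ _|m IHm /andP[_ mH]].
  exists finset.set0, [set 0]; split; rewrite ?finset.sub0set ?cards0 ?cards1 //.
    by rewrite finset.sub1set; apply: group1.
  by move=> s /set1P->; rewrite /law big_set0 ffunE eqxx.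
have [|B [S [BI SH /andP[Bm mS] lawS]]] := IHm; first by rewrite /= ltnW.
have [mS'|] := ltnP m.+1 #|S|.
  by exists B, S; split=> //; rewrite mS' ltnW.
rewrite leq_eqVlt ltnNge mS orbF => /eqP Sm.
pose stab := [set h | [forall s, (s \in S) ==> (h + s \in S)]].
have stabG : group_set stab.
  apply/group_setP; split=> [|h k].
    by rewrite inE; apply/forallP => s; apply/implyP; rewrite FinRing.zmod1gE add0r.
  rewrite !inE => /forallP Hh /forallP Hk; apply/forallP => s; apply/implyP => sS.
  rewrite FinRing.zmodMgE -addrA; apply: (implyP (Hh _)); exact: (implyP (Hk _)).
pose K := (H :&: Group stabG)%G.
have KH : K \proper H.
  (* If all of [H] stabilised [S], then [S] would contain a translate of [H], although #|S| = m.+1 <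
     #|H|. *)
  rewrite properE subsetIl /=; apply: contraTN mH => HK; rewrite -ltnNge ltnS -Sm.
  have /card_gt0P[s0 s0S] : (0 < #|S|)%N by rewrite Sm.
  have <- : #|[set h + s0 | h in H]| = #|H| by apply: card_imset; apply: addIr.
  apply: subset_leq_card.
  apply/fintype.subsetP => _ /imsetP[h Hh ->].
  have /setIP[_] := fintype.subsetP HK h Hh; rewrite inE => /forallP/(_ s0).
  by rewrite s0S.
(* [B] has fewer than #|H| elements, so it cannot use up all the indices escaping [K]. *)
have /subsetPn[i] : ~~ ([set i in I | F i \notin K] \subset B).
  apply: contraL (escape K KH) => /subset_leq_card le.
  by rewrite -ltnNge; apply: leq_ltn_trans le (leq_trans Bm _); apply: ltnW.
rewrite inE => /andP[iI iK] iB.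
have iS : F i \notin Group stabG by apply: contra iK => ?; apply/setIP; split; rewrite ?IH.
have [r [s [nur nus]]] := balanced_atoms i iS.
rewrite inE => /forallPn[t]; rewrite negb_imply => /andP[tS rsS].
(* The translate [S'] keeps the size m.+1, and t + F i *+ r is one more point, because t + (F i *+ r
   - F i *+ s) is not in [S]. *)
pose S' := [set u + F i *+ s | u in S].
have tS' : t + F i *+ r \notin S'.
  apply: contra rsS => /imsetP[u uS e].
  by rewrite addrAC [_ + t]addrC e addrK.
have card_S' : #|S'| = m.+1 by rewrite card_imset //; apply: addIr.
have step u q : u \in S -> atom_mass <= nu i q ->
    atom_mass ^+ #|i |: B| <= law nu F (i |: B) (u + F i *+ q).
  move=> uS nuq; rewrite law_setU1 // cardsU1 iB exprD mulrC conv_push (bigD1 q) //= addrK.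
  have [f0 _] : is_dist (law nu F B) by apply: dist_law.
  rewrite -[leLHS]addr0 lerD //; last first.
    by apply: sumr_ge0 => z _; rewrite mulr_ge0 //; case: (nuW i).
  by rewrite ler_pM ?exprn_ge0 ?lawS // ltW.
exists (i |: B), (t + F i *+ r |: S'); split.
- by rewrite finset.subUset finset.sub1set iI.
- rewrite finset.subUset finset.sub1set group_add ?group_mulrn ?IH ?(fintype.subsetP SH) //=.
  apply/fintype.subsetP => _ /imsetP[u uS ->].
  by rewrite group_add ?group_mulrn ?IH ?(fintype.subsetP SH).
- by rewrite !cardsU1 iB tS' card_S' add1n ltnS Bm /=.
- by move=> u /setU1P[->|/imsetP[v vS ->]]; apply: step.
Qed.

(** Doeblin's argument: [f] and [g] have mass 1 on [H], so the deviation of the convolution from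
    uniform is the convolution of f - 1/#|H| with g - c, and the latter is nonnegative of mass 1 - c
    #|H| <= 1 - c. *)
Lemma conv_contract f g H (c D : R) :
  is_dist f -> is_dist g -> (forall y, y \notin H -> f y = 0) ->
  (forall y, y \notin H -> g y = 0) -> 0 <= c ->
  (forall y, y \in H -> c <= g y) ->
  (forall y, y \in H -> `|f y - #|H|%:R^-1| <= D) ->
  forall y, y \in H -> `|conv f g y - #|H|%:R^-1| <= (1 - c) * D.
Proof.
move=> [f0 f1] [g0 g1] fH gH c0 cg fD y Hy.
have H0 : #|H|%:R != 0 :> R by rewrite pnatr_eq0 -lt0n.
have D0 : 0 <= D by apply: le_trans (fD y Hy).
have g1' : \sum_(z in H) g z = 1.
  by rewrite -g1 [RHS](bigID (mem H)) /= [X in _ + X]big1 ?addr0.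
have f1' : \sum_(z in H) f (y - z) = 1.
  rewrite -f1 [RHS](bigID (mem H)) /= [X in _ + X]big1 ?addr0 //.
  rewrite [RHS](reindex_inj (subrI y)) /=; apply: eq_bigl => z.
  by rewrite group_addl // group_opp.
have -> : conv f g y - #|H|%:R^-1 =
    \sum_(z in H) (f (y - z) - #|H|%:R^-1) * (g z - c).
  rewrite ffunE (bigID (mem H)) /= [X in _ + X - _]big1 ?addr0; last first.
    by move=> z Hz; rewrite gH ?mulr0.
  under [RHS]eq_bigr => z _ do rewrite mulrBl !mulrBr.
  rewrite !sumrB -mulr_sumr -mulr_suml g1' f1' sumr_const -mulr_natl.
  by field.
apply: le_trans (ler_norm_sum _ _ _) _.
apply: le_trans (_ : \sum_(z in H) D * (g z - c) <= _).
  apply: ler_sum => z Hz; rewrite normrM [`|g z - c|]ger0_norm ?subr_ge0 ?cg //.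
  apply: ler_wpM2r; first by rewrite subr_ge0 cg.
  by apply: fD; rewrite group_sub.
rewrite -mulr_sumr mulrC ler_wpM2r // sumrB g1' sumr_const lerD2l lerN2.
by rewrite -mulr_natl ler_peMl // ler1n.
Qed.

(** A lower bound for the point masses of every block, since a block has fewer than #|V| entries and
    [atom_mass] is at most 1. *)
Definition gamma : R := atom_mass ^+ #|V|.

Lemma gamma_bounds : 0 < gamma <= 1.
Proof. by rewrite /gamma exprn_gt0 // exprn_ile1 // ltW. Qed.

(** Each induction step removes a block [B] of fewer than #|H| indices whose law charges all of [H];
    convolving with it contracts the deviation by 1 - gamma, and enough escaping indices remain for
    m further blocks. *)
Lemma law_mixing H m I :
  (forall i, i \in I -> F i \in H) ->
  (forall K : {group V}, K \proper H -> m * #|H| <= #|[set i in I | F i \notin K]|)%N ->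
  forall y, y \in H -> `|law nu F I y - #|H|%:R^-1| <= (1 - gamma) ^+ m.
Proof.
elim: m I => [|m IHm] I IH escape y Hy.
  (* Without any block, both numbers merely lie in [0, 1]. *)
  have [f0 _] : is_dist (law nu F I) by apply: dist_law.
  have := dist_le1 y (dist_law F I nuW).
  have h0 : 0 <= #|H|%:R^-1 :> R by rewrite invr_ge0.
  have h1 : #|H|%:R^-1 <= 1 :> R by rewrite invf_le1 ?ler1n ?ltr0n.
  rewrite expr0 ler_norml => f1; move: (f0 y) => f0y; apply/andP; split; lra.
have [||B [S [BI SH /andP[Bm mS] lawS]]] := @law_support_growth H I #|H| IH.
- move=> K KH; apply: leq_trans (escape K KH); rewrite mulSn; exact: leq_addr.
- by rewrite cardG_gt0 leqnn.
(* Growth was run up to size #|H|, so the reached set is all of [H]. *)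
have {}SH : S = H by apply/eqP; rewrite eqEcard SH.
rewrite {}SH in lawS.
rewrite (law_split _ _ BI) exprS.
apply: (@conv_contract _ _ H) => //; try exact: dist_law.
- by move=> z; apply: law_out => i /setDP[/IH].
- by move=> z; apply: law_out => i /(fintype.subsetP BI)/IH.
- by rewrite exprn_ge0 // ltW.
- move=> z Hz; apply: le_trans (lawS z Hz); apply: ler_wiXn2l => //; first exact: ltW.
  by apply: ltnW; apply: leq_trans Bm _; apply: max_card.
move=> z Hz; apply: IHm => // [i /setDP[/IH]//|K KH].
have := escape K KH; rewrite mulSn.
have : (#|[set i in I | F i \notin K]| <= #|B| + #|[set i in I :\: B | F i \notin K]|)%N.
  apply: leq_trans (leq_card_setU _ _); apply: subset_leq_card; apply/fintype.subsetP => i.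
  by rewrite !inE => /andP[-> ->]; case: (i \in B).
move: Bm; lia.
Qed.

End Mixing.

(** * The lifting estimate *)

Section Counting.
Variables (V : finZmodType) (n : nat).
Implicit Types (U H K : {group V}) (F : {ffun 'I_n -> V}).

Definition miss F K := #|[set i | F i \notin K]|.

Definition maps_to U : {set {ffun 'I_n -> V}} := [set F : {ffun 'I_n -> V} | [forall i, F i \in U]].

(** These tuples are the surjections from the free module onto [U], given by the images of the
    basis. *)
Definition gens U : {set {ffun 'I_n -> V}} :=
  [set F : {ffun 'I_n -> V} | <<F @: [set: 'I_n]>>%g == U].

Lemma maps_toP U F : reflect (forall i, F i \in U) (F \in maps_to U).
Proof. by rewrite inE; apply: forallP. Qed.

Lemma mem_gens F U i : F \in gens U -> F i \in U.
Proof.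
by rewrite inE => /eqP <-; apply: mem_gen; apply: imset_f; rewrite inE.
Qed.

Lemma gens_maps_to U : gens U \subset maps_to U.
Proof. by apply/fintype.subsetP => F FU; apply/maps_toP => i; apply: mem_gens. Qed.

Lemma card_maps_to U : #|maps_to U| = (#|U| ^ n)%N.
Proof.
rewrite -[n in RHS]card_ord -card_ffun_on; apply: eq_card => F.
by rewrite inE; apply/forallP/ffun_onP.
Qed.

Lemma gens_generated F : F \in gens <<(F @: [set: 'I_n])%SET>>%G.
Proof. by rewrite inE. Qed.

Lemma maps_to_generated F U : F \in maps_to U -> <<(F @: [set: 'I_n])%SET>>%G \subset U.
Proof.
by move=> /maps_toP FU; rewrite gen_subG; apply/fintype.subsetP => _ /imsetP[i _ ->].
Qed.

(* [H] is the smallest subgroup with the first property. *)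
Lemma exists_well_spread_subgroup U F (b : nat) : F \in maps_to U ->
  exists H, [/\ H \subset U, (miss F H <= (#|U| - #|H|) * b)%N &
    forall K, K \proper H -> (b < #|[set i | F i \in H & F i \notin K]|)%N].
Proof.
move=> /maps_toP FU.
pose P (H : {group V}) := (H \subset U) && (miss F H <= (#|U| - #|H|) * b)%N.
have PU : P U.
  rewrite /P subxx /miss (_ : [set i | _] = finset.set0) ?cards0 //.
  by apply/setP => i; rewrite !inE FU.
case: (arg_minnP (fun H => #|H|) PU) => H /andP[HU missH] minH.
exists H; split=> // K KH; rewrite ltnNge; apply/negP => le.
have ltKH := proper_card KH.
have leHU := subset_leq_card HU.
(* Passing from [H] to [K] adds at most [b] missed entries, while the allowance grows by (#|H| -
   #|K|) * b >= b; so [K] would contradict the minimality of [H]. *)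
have /minH : P K.
  rewrite /P (fintype.subset_trans (proper_sub KH) HU) /=.
  have : (miss F K <= miss F H + #|[set i | F i \in H & F i \notin K]|)%N.
    apply: leq_trans (leq_card_setU _ _); apply: subset_leq_card.
    by apply/fintype.subsetP => i; rewrite !inE => ->; rewrite andbT orNb.
  have -> : (#|U| - #|K| = #|U| - #|H| + (#|H| - #|K|))%N by lia.
  have : (b <= (#|H| - #|K|) * b)%N by rewrite leq_pmull // subn_gt0.
  rewrite mulnDl; lia.
by rewrite leqNgt ltKH.
Qed.

(* Chernoff bound, with weight [s] for every coordinate outside [H]. *)
Lemma card_miss_le (R : realFieldType) U H (b : nat) (s : R) : 0 < s <= 1 ->
  #|[set F in maps_to U | (miss F H <= b)%N]|%:R
    <= s ^- b * (#|H|%:R + s * #|U|%:R) ^+ n.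
Proof.
move=> /andP[s0 s1].
pose phi x : R := if x \in H then 1 else s.
have phi0 x : 0 <= phi x by rewrite /phi; case: ifP => // _; apply: ltW.
have prod_phi F : \prod_i phi (F i) = s ^+ miss F H.
  under eq_bigr => i _ do rewrite /phi -if_neg.
  by rewrite -big_mkcond prodr_const /miss cardsE.
have sum_phi : \sum_(x in U) phi x <= #|H|%:R + s * #|U|%:R.
  apply: le_trans (_ : \sum_(x in U) ((x \in H)%:R + s) <= _).
    apply: ler_sum => x _; rewrite /phi; case: ifP => _; last by rewrite add0r.
    by rewrite lerDl ltW.
  rewrite big_split /= sumr_const mulr_natr lerD2r -natr_sum ler_nat.
  rewrite -sum1_card [leqRHS]big_mkcond [leqLHS]big_mkcond /=.
  by apply: leq_sum => x _; case: (x \in U); case: (x \in H).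
rewrite mulrC ler_pdivlMr ?exprn_gt0 //.
(* Each counted tuple contributes s ^+ miss F H >= s ^+ b, and the sum of the products over all
   tuples factors into a power. *)
apply: le_trans (_ : \sum_(F in maps_to U) \prod_i phi (F i) <= _); last first.
  rewrite (eq_bigl (mem (ffun_on (mem U)))); last first.
    by move=> F; rewrite inE; apply/forallP/ffun_onP.
  rewrite -(bigA_distr_big (mem U) (fun=> phi)) prodr_const card_ord.
  by rewrite lerXn2r ?nnegrE ?sumr_ge0 ?addr_ge0 ?mulr_ge0 ?ler0n // ltW.
rewrite mulr_natl -sumr_const big_mkcond [leRHS]big_mkcond /=.
apply: ler_sum => F _; rewrite [in X in X <= _]inE; case: (F \in _) => //=.
case: ifP => [le|_]; last by apply: prodr_ge0.
by rewrite prod_phi ler_wiXn2l // ltW.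
Qed.

End Counting.

(** Replaces one factor at a time; the bound is the value reached when every x j equals y * (1 +
    e). *)
Lemma prod_approx (R : realFieldType) (n : nat) (x : 'I_n -> R) (y e : R) :
  0 <= y -> 0 <= e -> (forall j, `|x j - y| <= y * e) ->
  `|\prod_j x j - y ^+ n| <= y ^+ n * ((1 + e) ^+ n - 1).
Proof.
move=> y0 e0; elim: n x => [|n IHn] x xy.
  by rewrite big_ord0 !expr0 !subrr mulr0 normr0.
rewrite big_ord_recl !exprS.
set X := \prod_(_ < _) _; set Y := y ^+ n; set E := (1 + e) ^+ n.
have IH : `|X - Y| <= Y * (E - 1) by apply: IHn => j; apply: xy.
have Y0 : 0 <= Y by rewrite exprn_ge0.
have -> : x ord0 * X - y * Y = x ord0 * (X - Y) + (x ord0 - y) * Y by ring.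
have -> : y * Y * ((1 + e) * E - 1) = y * (1 + e) * (Y * (E - 1)) + y * e * Y by ring.
apply: le_trans (ler_normD _ _) _; rewrite !normrM (ger0_norm Y0).
apply: lerD; last by rewrite ler_wpM2r.
apply: ler_pM => //; rewrite mulrDr mulr1.
by rewrite -[x ord0](subrK y) addrC (le_trans (ler_normD _ _)) // ger0_norm ?lerD2l.
Qed.

(** The union bound for nonnegative weights. *)
Lemma sum_cover_le (R : numDomainType) (I J : finType) (A : {set I}) (P : pred J)
    (S : J -> {set I}) (x : I -> R) :
  (forall i, 0 <= x i) -> (forall i, i \in A -> exists2 j, P j & i \in S j) ->
  \sum_(i in A) x i <= \sum_(j | P j) \sum_(i in S j) x i.
Proof.
move=> x0 cover; rewrite (exchange_big_dep predT) //= big_mkcond.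
apply: ler_sum => i _; case: ifP => iA; last exact: sumr_ge0.
have [j Pj iSj] := cover i iA.
by rewrite (bigD1 j) ?Pj //= lerDl sumr_ge0.
Qed.

(** * Expected number of generating tuples sent to a given tuple *)

Section Lift.
Variables (R : realFieldType) (V : finZmodType) (a : nat) (alpha : R).
Hypotheses (a_gt1 : (1 < a)%N) (Va : forall x : V, x *+ a = 0).
Hypotheses (alpha_gt0 : 0 < alpha) (alpha_le : alpha <= 1 / 2).
Implicit Types (U H K : {group V}).

Definition apply_mx n (F : {ffun 'I_n -> V}) (A : 'M['Z_a]_n) : {ffun 'I_n -> V} :=
  [ffun j => \sum_i F i *+ A i j].

Definition mx_weight n (nu : 'I_n -> 'I_n -> 'Z_a -> R) (A : 'M['Z_a]_n) : R :=
  \prod_i \prod_j nu i j (A i j).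

(** The j-th entry of the image depends only on the j-th column, and the columns are independent. *)
Lemma sum_apply_mx_law n (nu : 'I_n -> 'I_n -> 'Z_a -> R) (F F' : {ffun 'I_n -> V}) :
  \sum_(A | apply_mx F A == F') mx_weight nu A =
  \prod_j law (fun i => nu i j) F [set: 'I_n] (F' j).
Proof.
under [RHS]eq_bigr => j _ do rewrite law_setT.
rewrite bigA_distr_big_dep /=.
pose mx_of (f : {ffun 'I_n -> {ffun 'I_n -> 'Z_a}}) : 'M['Z_a]_n := \matrix_(i, j) f j i.
rewrite (reindex mx_of) /=; last first.
  exists (fun A : 'M['Z_a]_n => [ffun j => [ffun i => A i j]]) => [f|A] _.
    by apply/ffunP => j; apply/ffunP => i; rewrite !ffunE mxE.
  by apply/matrixP => i j; rewrite mxE !ffunE.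
apply: eq_big => [f|f _].
  apply/eqP/familyP => [<- j|e]; last apply/ffunP => j.
    by rewrite unfold_in ffunE; apply/eqP/eq_bigr => i _; rewrite mxE.
  rewrite ffunE -(eqP (e j)); apply: eq_bigr => i _; by rewrite mxE.
rewrite /mx_weight exchange_big; apply: eq_bigr => j _; apply: eq_bigr => i _.
by rewrite mxE.
Qed.

Let rho := 1 - gamma V a alpha.

Let alpha_le1 : alpha <= 1. Proof. move: alpha_le => ?; lra. Qed.

Let rho_ge0 : 0 <= rho. Proof. by rewrite subr_ge0; case/andP: (gamma_bounds V a_gt1 alpha_gt0 alpha_le1). Qed.

Section FixedSize.
Variables (n m : nat) (nu : 'I_n -> 'I_n -> 'Z_a -> R).
Hypothesis nuP : forall i j, balanced_weight alpha (nu i j).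
Implicit Types F : {ffun 'I_n -> V}.

Let N := #|V|.
Let b := (m * N)%N.
Let q F j y := law (fun i => nu i j) F [set: 'I_n] y.

Let q_ge0 F j y : 0 <= q F j y.
Proof.
have nuW i : is_weight (nu i j) by case: (nuP i j).
by have [+ _] := @dist_law R V a n (fun i => nu i j) F [set: 'I_n] nuW; apply.
Qed.

(** The threshold b = m * #|V| leaves room for [m] disjoint blocks of fewer than #|H| indices
    each. *)
Definition well_spread F H := [forall (K : {group V} | K \proper H),
  (b < #|[set i | F i \in H & F i \notin K]|)%N].

Lemma well_spread_mixing F H : well_spread F H ->
  forall j y, y \in H ->
  `|law (fun i => nu i j) F [set i | F i \in H] y - #|H|%:R^-1| <= rho ^+ m.
Proof.
move=> FH j y Hy; apply: law_mixing => // [i|K KH].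
  by rewrite inE.
apply: leq_trans (_ : b <= _)%N; first by rewrite leq_mul2l max_card orbT.
apply: leq_trans (ltnW (forall_inP FH K KH)) _; apply: subset_leq_card.
by apply/fintype.subsetP => i; rewrite !inE.
Qed.

Lemma well_spread_full F U : F \in maps_to n U -> well_spread F U ->
  forall j y, y \in U -> `|q F j y - #|U|%:R^-1| <= rho ^+ m.
Proof.
move=> /maps_toP FU dU j y Uy; rewrite /q (_ : [set: _] = [set i | F i \in U]).
  exact: well_spread_mixing.
by apply/setP => i; rewrite !inE FU.
Qed.

(** The entries outside [H], of which there is at least one since [F] generates [U], must bring the
    sum into the coset of [y], with probability at most 1 - alpha; the entries inside [H] must then
    hit one prescribed point. *)
Lemma well_spread_proper F U H : F \in gens n U -> H \proper U -> well_spread F H ->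
  forall j y, q F j y <= (1 - alpha) * (#|H|%:R^-1 + rho ^+ m).
Proof.
move=> FU /andP[HU nUH] dH j y; set I := [set i | F i \in H].
have [i Hi] : exists i, F i \notin H.
  apply/existsP; apply: contraR nUH; rewrite negb_exists => /forallP FH.
  move: FU; rewrite inE => /eqP <-; rewrite gen_subG; apply/fintype.subsetP => _ /imsetP[i _ ->].
  by have := FH i; rewrite negbK.
have nuW k : is_weight (nu k j) by case: (nuP k j).
rewrite /q (law_split _ _ (finset.subsetT I)) ffunE.
have [f0 _] := @dist_law R V a n (fun i => nu i j) F ([set: 'I_n] :\: I) nuW.
apply: le_trans (_ : \sum_(z in H) law (fun i => nu i j) F ([set: 'I_n] :\: I) (y - z)
   * (#|H|%:R^-1 + rho ^+ m) <= _).
  rewrite [leRHS]big_mkcond; apply: ler_sum => z _; case: ifP => Hz.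
    apply: ler_wpM2l => //; rewrite -lerBlDl.
    by apply: le_trans (ler_norm _) _; apply: well_spread_mixing.
  by rewrite (@law_out _ _ _ _ _ _ H I) ?Hz // ?mulr0 // => k; rewrite inE.
rewrite -mulr_suml; apply: ler_wpM2r; first by rewrite addr_ge0 ?invr_ge0 ?exprn_ge0.
rewrite (reindex_inj (subrI y)) /=.
under eq_bigr => z _ do rewrite subKr.
under eq_bigl => z do rewrite -group_opp opprB.
by apply: (law_coset_le _ _ _ _ _ Hi) => //; rewrite !inE Hi.
Qed.

(** [s] is the Chernoff weight of an entry outside the subgroup, small enough that s * #|U| <= alpha
    / 2 for all [U]. [theta] is the resulting decay per coordinate, and [T] bounds the ratio of a
    nearly uniform point mass to the uniform one. *)
Variable s : R.
Hypothesis sN : s * N%:R = alpha / 2.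
Let theta := 1 - alpha / 2.
Let T := 1 + N%:R * rho ^+ m.

Let N_gt0 : 0 < N%:R :> R.
Proof. by rewrite ltr0n; apply/card_gt0P; exists 0. Qed.

Let card_le U : #|U|%:R <= N%:R :> R.
Proof. by rewrite ler_nat max_card. Qed.

Let card_gt0 U : 0 < #|U|%:R :> R.
Proof. by rewrite ltr0n cardG_gt0. Qed.

Let s_gt0 : 0 < s.
Proof. by rewrite -(pmulr_lgt0 _ N_gt0) sN divr_gt0. Qed.

Let s_le : s <= alpha / 2.
Proof. by rewrite -sN; apply: ler_peMr; rewrite ?(ltW s_gt0) // ler1n -(ltr0n R). Qed.

Let su_ge0 U : 0 <= s * #|U|%:R.
Proof. by apply: mulr_ge0; [apply: ltW|apply: ler0n]. Qed.

Let s_unit : 0 < s <= 1.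
Proof. by rewrite s_gt0 (le_trans s_le) //; move: alpha_le => ?; lra. Qed.

Let T_ge1 : 1 <= T.
Proof. by rewrite lerDl mulr_ge0 ?exprn_ge0 ?ler0n. Qed.

Let theta_ge0 : 0 <= theta.
Proof. by rewrite /theta; move: alpha_le => ?; lra. Qed.

Let card_proper K U : K \proper U -> #|K|%:R * 2 <= #|U|%:R :> R.
Proof.
move=> KU; rewrite -natrM ler_nat.
have /dvdnP[k e] := cardSg (proper_sub KU).
have := proper_card KU; rewrite e -[X in (X < _)%N]mul1n ltn_pmul2r //.
by move=> k1; rewrite mulnC leq_mul2r k1 orbT.
Qed.

(** Per coordinate the bound is #|K| / #|U| + s <= 1/2 + alpha / 2, which is at most [theta] because
    alpha <= 1/2. *)
Let count_full U K : K \proper U ->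
  #|[set F in maps_to n U | (miss F K <= b)%N]|%:R * #|U|%:R ^- n <= s ^- b * theta ^+ n.
Proof.
move=> KU; apply: le_trans (_ : s ^- b * (#|K|%:R + s * #|U|%:R) ^+ n * #|U|%:R ^- n <= _).
  by rewrite ler_wpM2r ?invr_ge0 ?exprn_ge0 ?ler0n // card_miss_le.
rewrite -mulrA ler_wpM2l ?invr_ge0 ?exprn_ge0 ?(ltW s_gt0) //.
rewrite -exprVn -exprMn.
have c0 : 0 <= (#|K|%:R + s * #|U|%:R) * #|U|%:R^-1.
  by rewrite mulr_ge0 ?invr_ge0 ?addr_ge0 ?ler0n.
rewrite lerXn2r ?nnegrE // ler_pdivrMr ?card_gt0 //.
have h : s * #|U|%:R <= (alpha / 2) * #|U|%:R by rewrite ler_wpM2r ?ler0n.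
have h' : (alpha - 1 / 2) * #|U|%:R <= 0 by rewrite mulr_le0_ge0 ?ler0n ?subr_le0.
move: h h' (card_proper KU); rewrite /theta => *; lra.
Qed.

(** Per coordinate, the number of choices costs #|H| * (1 + alpha / 2) and the probability gains (1
    - alpha) / #|H| up to [T]; the product (1 + alpha / 2) * (1 - alpha) stays below [theta]. *)
Let count_proper U H : H \proper U ->
  #|[set F in maps_to n U | (miss F H <= N * b)%N]|%:R *
    ((1 - alpha) * (#|H|%:R^-1 + rho ^+ m)) ^+ n <= s ^- (N * b) * theta ^+ n * T ^+ n.
Proof.
move=> HU; have rm : 0 <= rho ^+ m by rewrite exprn_ge0.
have a1 : 0 <= 1 - alpha by rewrite subr_ge0.
have hV : 0 <= #|H|%:R^-1 + rho ^+ m by rewrite addr_ge0 ?invr_ge0 ?ler0n.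
apply: le_trans (_ : s ^- (N * b) * (#|H|%:R + s * #|U|%:R) ^+ n *
   ((1 - alpha) * (#|H|%:R^-1 + rho ^+ m)) ^+ n <= _).
  by rewrite ler_wpM2r ?exprn_ge0 ?mulr_ge0 // card_miss_le.
rewrite -!mulrA ler_wpM2l ?invr_ge0 ?exprn_ge0 ?(ltW s_gt0) //.
have T0 : 0 <= T by apply: le_trans T_ge1.
have su : 0 <= #|H|%:R + s * #|U|%:R.
  by rewrite addr_ge0 ?ler0n.
have a2 : 0 <= (1 - alpha) * (#|H|%:R^-1 + rho ^+ m) by rewrite mulr_ge0.
rewrite -!exprMn; apply: lerXn2r; rewrite ?nnegrE ?mulr_ge0 //.
have h1 : #|H|%:R + s * #|U|%:R <= #|H|%:R * (1 + alpha / 2).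
  rewrite mulrDr mulr1 lerD2l.
  apply: le_trans (_ : alpha / 2 <= _); first by rewrite -sN ler_wpM2l // ltW.
  by rewrite ler_peMl ?ler1n // divr_ge0 // ltW.
have h2 : #|H|%:R^-1 + rho ^+ m <= #|H|%:R^-1 * T.
  rewrite /T mulrDr mulr1 lerD2l mulrA ler_peMl // mulrC ler_pdivlMr ?card_gt0 //.
  by rewrite mul1r.
have h3 : (1 + alpha / 2) * (1 - alpha) <= theta.
  by rewrite /theta; move: (mulr_gt0 alpha_gt0 alpha_gt0) alpha_gt0 => *; nra.
apply: le_trans (_ : #|H|%:R * (1 + alpha / 2) * ((1 - alpha) * (#|H|%:R^-1 * T)) <= _).
  by apply: ler_pM; rewrite ?mulr_ge0 ?ler_wpM2l.
have -> : #|H|%:R * (1 + alpha / 2) * ((1 - alpha) * (#|H|%:R^-1 * T)) =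
    (1 + alpha / 2) * (1 - alpha) * T.
  by move: (lt0r_neq0 (card_gt0 H)) => ?; field.
by rewrite ler_wpM2r.
Qed.

(** Compares the sum with the identity that #|U| ^- n summed over all tuples of [U] is 1. The three
    error terms come from the tuples well spread in [U], the other tuples in the identity, and the
    other generating tuples. *)
Lemma lift_estimate U (F' : {ffun 'I_n -> V}) : F' \in maps_to n U ->
  `|\sum_(F in gens n U) \sum_(A | apply_mx F A == F') mx_weight nu A - 1| <=
  (T ^+ n - 1) + #|{: {group V}}|%:R * (s ^- b * theta ^+ n)
    + #|{: {group V}}|%:R * (s ^- (N * b) * theta ^+ n * T ^+ n).
Proof.
move=> /maps_toP F'U.
under eq_bigr => F _ do rewrite sum_apply_mx_law.
pose G := [set F in maps_to n U | well_spread F U].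
(* A tuple generating a proper subgroup has no entry outside it, so it is not well spread in [U]. *)
have sGU : G \subset gens n U.
  apply/fintype.subsetP => F; rewrite inE => /andP[FU /forall_inP dF].
  have [FK|] := boolP (<<(F @: [set: 'I_n])%SET>>%G \proper U).
    have := dF _ FK; rewrite (_ : [set i | _] = finset.set0) ?cards0 //.
    by apply/setP => i; rewrite !inE (mem_gens i (gens_generated F)) andbF.
  rewrite properE maps_to_generated //= negbK => sU.
  by rewrite inE finset.eqEsubset sU andbT; apply: maps_to_generated.
have card_u : \sum_(F in maps_to n U) #|U|%:R ^- n = 1 :> R.
  rewrite sumr_const card_maps_to -[LHS]mulr_natr natrX mulVf //.
  by rewrite expf_neq0 // gt_eqF.
rewrite (big_setID G) /= (finset.setIidPr sGU) -[X in _ - X]card_u [X in _ - X](big_setID G) /=.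
rewrite (finset.setIidPr (fintype.subset_trans sGU (gens_maps_to n U))).
set A := \sum_(_ in G) _; set B := \sum_(_ in gens n U :\: G) _.
set C := \sum_(_ in G) _; set D := \sum_(_ in maps_to n U :\: G) _.
have n_proper (P : pred {group V}) (c : R) : 0 <= c ->
    \sum_(K : {group V} | P K) c <= #|{: {group V}}|%:R * c.
  by move=> c0; rewrite sumr_const -[leLHS]mulr_natl ler_wpM2r // ler_nat max_card.
have hAC : `|A - C| <= T ^+ n - 1.
  rewrite /A /C -sumrB; apply: le_trans (ler_norm_sum _ _ _) _.
  apply: le_trans (_ : \sum_(F in maps_to n U) #|U|%:R ^- n * (T ^+ n - 1) <= _).
    rewrite big_mkcond [leRHS]big_mkcond; apply: ler_sum => F _.
    rewrite inE; case: (boolP (F \in maps_to n U)) => //= FU.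
    have Tn : 0 <= #|U|%:R ^- n * (T ^+ n - 1).
      by rewrite mulr_ge0 ?invr_ge0 ?exprn_ge0 ?ler0n // subr_ge0 exprn_ege1.
    (* The deviation rho ^+ m of a column is at most #|V| * rho ^+ m relative to 1 / #|U|. *)
    case: ifP => // dF; rewrite -exprVn /T.
    apply: prod_approx => [||j]; rewrite ?invr_ge0 ?mulr_ge0 ?exprn_ge0 ?ler0n //.
    apply: le_trans (well_spread_full FU dF j (F'U j)) _.
    rewrite mulrA ler_peMl ?exprn_ge0 // mulrC ler_pdivlMr ?card_gt0 //.
    by rewrite mul1r.
  by rewrite -mulr_suml card_u mul1r.
(* Failing to be well spread in [U] means that some proper [K] misses at most [b] entries. *)
have hD : 0 <= D <= #|{: {group V}}|%:R * (s ^- b * theta ^+ n).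
  rewrite sumr_ge0 /=; last by move=> *; rewrite invr_ge0 exprn_ge0 ?ler0n.
  apply: le_trans (_ : \sum_(K : {group V} | K \proper U)
      \sum_(F in [set F in maps_to n U | (miss F K <= b)%N]) #|U|%:R ^- n <= _).
    apply: sum_cover_le => [F|F]; first by rewrite invr_ge0 exprn_ge0 ?ler0n.
    rewrite !inE => /andP[nG FU]; move: nG; rewrite FU /= => /forall_inPn[K KU].
    rewrite -leqNgt => le; exists K => //; rewrite inE; apply/andP; split; first by rewrite inE.
    apply: leq_trans le; apply: subset_leq_card; apply/fintype.subsetP => i.
    by rewrite !inE => ->; rewrite andbT; apply: (forallP FU).
  apply: le_trans (n_proper (fun K => K \proper U) _ _).
    by apply: ler_sum => K KU; rewrite sumr_const -[leLHS]mulr_natl count_full.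
  by rewrite mulr_ge0 ?exprn_ge0 // invr_ge0 exprn_ge0 // ltW.
(* The subgroup [H] attached to such a tuple is proper, since H = U would make it well spread in
   [U]; each [H] costs the count of its tuples times the column bound to the power [n]. *)
have hB : 0 <= B <= #|{: {group V}}|%:R * (s ^- (N * b) * theta ^+ n * T ^+ n).
  rewrite sumr_ge0 /=; last by move=> F _; apply: prodr_ge0 => j _; apply: q_ge0.
  pose S H := [set F in gens n U | (miss F H <= N * b)%N && well_spread F H].
  apply: le_trans (_ : \sum_(H : {group V} | H \proper U)
      \sum_(F in S H) \prod_j q F j (F' j) <= _).
    apply: sum_cover_le => [F|F]; first by apply: prodr_ge0 => j _; apply: q_ge0.
    move=> /setDP[FU nG]; have FmU := fintype.subsetP (gens_maps_to n U) F FU.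
    have [H [HU missH dH]] := exists_well_spread_subgroup b FmU.
    have {}dH : well_spread F H by apply/forall_inP.
    exists H.
      rewrite properE HU; apply: contra nG => UH.
      by rewrite inE FmU (_ : U = H) //; apply/val_inj/eqP; rewrite finset.eqEsubset UH.
    rewrite inE FU dH andbT /=; apply: leq_trans missH _; rewrite leq_mul2r.
    by rewrite (leq_trans (leq_subr _ _) (max_card _)) orbT.
  apply: le_trans (n_proper (fun K => K \proper U) _ _); last first.
    rewrite !mulr_ge0 ?exprn_ge0 ?(le_trans ler01 T_ge1) //.
    by rewrite invr_ge0 exprn_ge0 // ltW.
  apply: ler_sum => H HU; apply: le_trans (count_proper HU).
  have c0 : 0 <= (1 - alpha) * (#|H|%:R^-1 + rho ^+ m).
    by rewrite mulr_ge0 ?subr_ge0 ?addr_ge0 ?invr_ge0 ?exprn_ge0 ?ler0n.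
  apply: le_trans (_ : \sum_(F in S H) ((1 - alpha) * (#|H|%:R^-1 + rho ^+ m)) ^+ n <= _).
    apply: ler_sum => F; rewrite inE => /and3P[FU _ dF].
    rewrite -[n in leRHS]card_ord -prodr_const; apply: ler_prod => j _.
    by rewrite q_ge0; apply: (well_spread_proper FU HU dF).
  rewrite sumr_const -[leLHS]mulr_natl ler_wpM2r ?exprn_ge0 // ler_nat.
  apply: subset_leq_card; apply/fintype.subsetP => F; rewrite inE => /and3P[FU le _].
  by rewrite inE le andbT; apply: (fintype.subsetP (gens_maps_to n U)).
have -> : A + B - (C + D) = (A - C) + (B - D) by ring.
apply: le_trans (ler_normD _ _) _; rewrite -addrA; apply: lerD => //.
by case/andP: hD => ? ?; case/andP: hB => ? ?; rewrite ler_norml; apply/andP; split; lra.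
Qed.

End FixedSize.
End Lift.

(** * Exponential decay of the error terms *)

Section Asymptotics.
Variable R : realType.

Lemma expr_le_eventually (theta x : R) : 0 < theta < 1 -> 0 < x ->
  exists2 L, (0 < L)%N & theta ^+ L <= x.
Proof.
(* Any integer above ln x / ln theta works; the successor also makes it positive. *)
move=> /andP[t0 t1] x0; exists (Num.bound `|ln x / ln theta|).+1 => //.
have lt0 : ln theta < 0 by apply: ln_lt0; rewrite t0.
have bnd : ln x / ln theta <= (Num.bound `|ln x / ln theta|).+1%:R.
  apply: le_trans (ler_norm _) (le_trans (ltW (archi_boundP (normr_ge0 _))) _).
  by rewrite ler_nat.
move: bnd; set L := _.+1 => bnd.
rewrite -[x in leRHS]lnK // -[theta in leLHS]lnK // -expRM_natl ler_expR.
by rewrite -ler_ndivrMr.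
Qed.

Lemma expr_div_decay (tau : R) (D : nat) : 0 < tau < 1 -> (0 < D)%N ->
  exists K c, [/\ 0 < K, 0 < c &
    forall n, tau ^+ (n %/ D) <= K * expR (- c * n%:R)].
Proof.
move=> /andP[t0 t1] D0; have lt0 : ln tau < 0 by apply: ln_lt0; rewrite t0.
have D0' : 0 < D%:R :> R by rewrite ltr0n.
(* Rounding n / D down loses at most one factor [tau], which the constant tau^-1 restores. *)
exists tau^-1, (- ln tau / D%:R); split.
- by rewrite invr_gt0.
- by rewrite divr_gt0 // oppr_gt0.
move=> n; rewrite -[tau in leLHS]lnK // -expRM_natl -[tau in tau^-1]lnK // -expRN -expRD ler_expR.
have h : n%:R / D%:R <= (n %/ D)%:R + 1 :> R.
  rewrite ler_pdivrMr // natr1 -natrM ler_nat; exact: ltnW (ltn_ceil n D0).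
have -> : - ln tau + - (- ln tau / D%:R) * n%:R = ln tau * (n%:R / D%:R - 1) by ring.
by rewrite mulrC ler_nM2l // lerBlDr.
Qed.

Lemma expR_sub1_le (y : R) : expR y - 1 <= y * expR y.
Proof.
have := expR_ge1Dx (- y); rewrite expRN => h.
have e0 := expR_gt0 y.
have : expR y * (1 - y) <= 1 by rewrite -ler_pdivlMl // mulr1.
by move=> ?; lra.
Qed.

(** With sg = 1 - g / 2 one has 1 - g <= sg ^+ 2. One factor sg ^+ m absorbs m.+1, as m.+1 * sg ^+ m
    is at most the geometric sum, hence at most 2 / g. *)
Lemma mulSn_expr_le (g : R) (m : nat) : 0 < g <= 1 ->
  m.+1%:R * (1 - g) ^+ m <= 2 / g * (1 - g / 2) ^+ m.
Proof.
move=> /andP[g0 g1]; set sg := 1 - g / 2.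
have s0 : 0 <= sg by rewrite /sg; lra.
have s1 : sg <= 1 by rewrite /sg; lra.
have g1' : 0 <= 1 - g by rewrite subr_ge0.
have h1 : (1 - g) ^+ m <= sg ^+ m * sg ^+ m.
  rewrite -exprMn; apply: lerXn2r; rewrite ?nnegrE ?mulr_ge0 //.
  by rewrite /sg; move: (mulr_gt0 g0 g0) => *; nra.
have h2 : m.+1%:R * sg ^+ m <= 2 / g.
  apply: le_trans (_ : \sum_(i < m.+1) sg ^+ i <= _).
    rewrite mulr_natl -[m.+1 in leLHS]card_ord -sumr_const; apply: ler_sum => i _.
    by apply: ler_wiXn2l => //; rewrite -ltnS.
  rewrite ler_pdivlMr //; have := subrX1 sg m.+1.
  have : 0 <= sg ^+ m.+1 by rewrite exprn_ge0.
  rewrite /sg => h e; move: h e; set S := \sum_(_ < _) _; set X := _ ^+ _ => h e; lra.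
apply: le_trans (_ : m.+1%:R * (sg ^+ m * sg ^+ m) <= _).
  by apply: ler_wpM2l; rewrite ?ler0n.
by rewrite mulrA ler_wpM2r ?exprn_ge0.
Qed.

(** Taking [m] to be a small fixed proportion of [n] lets theta ^+ n beat the Chernoff factors,
    which are exponential in [m], while n * (1 - g) ^+ m still decays exponentially. *)
Lemma error_decay (N G : nat) (theta g s : R) : 0 < theta < 1 -> 0 < g <= 1 ->
  0 < s <= 1 ->
  exists K c, [/\ 0 < K, 0 < c & forall n, exists m,
    ((1 + N%:R * (1 - g) ^+ m) ^+ n - 1) + G%:R * (s ^- (m * N) * theta ^+ n)
      + G%:R * (s ^- (N * (m * N)) * theta ^+ n * (1 + N%:R * (1 - g) ^+ m) ^+ n)
    <= K * expR (- c * n%:R)].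
Proof.
move=> tP gP /andP[s0 s1]; have [t0 t1] := andP tP; have [g0 g1] := andP gP.
have [L L0 HL] := @expr_le_eventually theta (s ^+ (N * N)) tP (exprn_gt0 _ s0).
pose sg := 1 - g / 2; pose tau := Num.max sg theta.
have sg0 : 0 <= sg by rewrite /sg; lra.
have tauP : 0 < tau < 1.
  have sg1 : sg < 1 by rewrite /sg; lra.
  by apply/andP; split; rewrite /tau ?lt_max ?gt_max ?t0 ?orbT // sg1 t1.
have D0 : (0 < 2 * L)%N by lia.
have [K [c [K0 c0 Kc]]] := expr_div_decay tauP D0.
(* Since n <= 2 * L * m.+1, [C] bounds n * N * (1 - g) ^+ m up to the factor sg ^+ m. *)
pose C := (2 * L)%:R * N%:R * (2 / g) : R.
have C0 : 0 <= C.
  by apply: mulr_ge0; [rewrite mulr_ge0 ?ler0n|rewrite divr_ge0 // ltW].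
pose K1 := C * expR C + G%:R + G%:R * expR C + 1.
have eC := expR_ge0 C.
have K1P : 0 < K1.
  have CeC : 0 <= C * expR C by exact: mulr_ge0.
  have GeC : 0 <= G%:R * expR C by apply: mulr_ge0.
  by rewrite /K1 ltr_wpDl // !addr_ge0.
exists (K1 * K), c; split => // [|n]; first exact: mulr_gt0.
pose m := (n %/ (2 * L))%N; exists m.
have mn : (2 * L * m <= n)%N by rewrite mulnC leq_trunc_div.
have nm : (n <= 2 * L * m.+1)%N by rewrite mulnC; apply: ltnW; apply: ltn_ceil.
have theta_tau : theta <= tau by rewrite /tau le_max lexx orbT.
have sg_tau : sg <= tau by rewrite /tau le_max lexx.
have tau_ge0 : 0 <= tau by apply: le_trans sg_tau.
have tm : theta ^+ m <= tau ^+ m by rewrite lerXn2r ?nnegrE // ltW.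
have sm : sg ^+ m <= tau ^+ m by rewrite lerXn2r ?nnegrE.
have tau0 : 0 <= tau ^+ m by rewrite exprn_ge0.
set T := 1 + _.
pose y := n%:R * (N%:R * (1 - g) ^+ m).
have rm : 0 <= (1 - g) ^+ m by rewrite exprn_ge0 // subr_ge0.
have Ty : T ^+ n <= expR y.
  rewrite /y expRM_natl; apply: lerXn2r; rewrite ?nnegrE ?expR_ge0 ?expR_ge1Dx //.
  by rewrite addr_ge0 ?mulr_ge0 ?ler0n.
have yC : y <= C * sg ^+ m.
  apply: le_trans (_ : (2 * L * m.+1)%:R * (N%:R * (1 - g) ^+ m) <= _).
    by rewrite ler_wpM2r ?mulr_ge0 ?ler0n // ler_nat.
  have -> : (2 * L * m.+1)%:R * (N%:R * (1 - g) ^+ m) =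
      (2 * L)%:R * N%:R * (m.+1%:R * (1 - g) ^+ m) by rewrite natrM; ring.
  rewrite /C -[leRHS]mulrA; apply: ler_wpM2l; last exact: mulSn_expr_le.
  by rewrite mulr_ge0 ?ler0n.
have yC' : y <= C.
  apply: le_trans yC _; rewrite ler_piMr // exprn_ile1 // /sg; lra.
have y0 : 0 <= y by rewrite !mulr_ge0 ?ler0n.
have TC : T ^+ n <= expR C by apply: le_trans Ty _; rewrite ler_expR.
have b1 : T ^+ n - 1 <= C * expR C * tau ^+ m.
  apply: le_trans (_ : expR y - 1 <= _); first by rewrite lerD2r.
  apply: le_trans (expR_sub1_le y) _; rewrite [leRHS]mulrAC.
  apply: ler_pM; rewrite ?expR_ge0 ?ler_expR //.
  by apply: le_trans yC _; apply: ler_wpM2l.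
(* From n >= 2 * L * m >= m + L * m: the part theta ^+ (L * m) cancels the power of [s] by the
   choice of [L], and theta ^+ m is left. *)
have b3 : s ^- (N * (m * N)) * theta ^+ n <= tau ^+ m.
  apply: le_trans tm; rewrite mulrC ler_pdivrMr ?exprn_gt0 //.
  apply: le_trans (_ : theta ^+ (m + L * m) <= _).
    apply: ler_wiXn2l; rewrite ?(ltW t0) ?(ltW t1) //.
    apply: leq_trans mn; rewrite mulSn mul1n mulnDl leq_add2r.
    by rewrite leq_pmull.
  rewrite exprD ler_wpM2l ?exprn_ge0 ?(ltW t0) // exprM.
  rewrite (_ : (N * (m * N) = N * N * m)%N); last by rewrite mulnCA mulnC.
  rewrite exprM; apply: lerXn2r; rewrite ?nnegrE ?exprn_ge0 // ltW //.
have b2 : s ^- (m * N) * theta ^+ n <= tau ^+ m.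
  apply: le_trans b3; rewrite ler_wpM2r ?exprn_ge0 ?(ltW t0) //.
  rewrite lef_pV2 ?posrE ?exprn_gt0 //; apply: ler_wiXn2l; rewrite ?(ltW s0) //.
  by case: (N) => [|N']; rewrite ?muln0 ?mul0n // leq_pmull.
apply: le_trans (_ : K1 * tau ^+ m <= _); last first.
  by rewrite -mulrA; apply: ler_wpM2l (Kc n); apply: ltW.
have b2' : G%:R * (s ^- (m * N) * theta ^+ n) <= G%:R * tau ^+ m.
  by apply: ler_wpM2l; rewrite ?ler0n.
have b3' : G%:R * (s ^- (N * (m * N)) * theta ^+ n * T ^+ n) <= G%:R * expR C * tau ^+ m.
  rewrite -[leRHS]mulrA; apply: ler_wpM2l => //; rewrite [leRHS]mulrC; apply: ler_pM => //.
    by rewrite mulr_ge0 ?invr_ge0 ?exprn_ge0 // ltW.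
  by rewrite exprn_ge0 // addr_ge0 ?mulr_ge0 ?ler0n.
rewrite /K1 !mulrDl mul1r; apply: le_trans (lerD (lerD b1 b2') b3') _.
by rewrite lerDl.
Qed.

End Asymptotics.

(** * Induction on the number of factors *)

Section Chains.
Variable gT : finGroupType.
Implicit Types (U H : {group gT}) (k : nat).

Lemma n_chains0 U : n_chains 0 U = (U == 1%G).
Proof.
rewrite /n_chains; have [->|U1] := eqVneq U 1%G.
  rewrite (_ : nested_chains _ _ = [set [ffun=> 1%G]]) ?cards1 //.
  apply/setP => C; rewrite !inE; apply/and3P/eqP => [[/eqP C0 _ _]|->].
    by apply/ffunP => i; rewrite ffunE ord1.
  rewrite !ffunE; split=> //; apply/forallP => i; apply/forallP => j.
  by rewrite !ffunE subxx implybT.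
rewrite (_ : nested_chains _ _ = finset.set0) ?cards0 //.
apply/setP => C; rewrite !inE; apply/negP => /and3P[/eqP C0 /eqP CU _].
by move: U1; rewrite -CU -C0 (_ : ord_max = ord0) ?eqxx //; apply/val_inj.
Qed.

(** Classifies the chains by their term just before the last; dropping the last term, which is [U],
    is then a bijection. *)
Lemma n_chainsS k U : n_chains k.+1 U = \sum_(H : {group gT} | H \subset U) n_chains k H.
Proof.
pose last_proper (C : {ffun 'I_k.+2 -> {group gT}}) := C (lift ord_max ord_max).
pose snoc (C : {ffun 'I_k.+1 -> {group gT}}) : {ffun 'I_k.+2 -> {group gT}} :=
  [ffun i => oapp C U (unlift ord_max i)].
pose belast (C : {ffun 'I_k.+2 -> {group gT}}) : {ffun 'I_k.+1 -> {group gT}} :=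
  [ffun i => C (lift ord_max i)].
have snocl C i : snoc C (lift ord_max i) = C i by rewrite ffunE liftK.
have snocU C : snoc C ord_max = U by rewrite ffunE unlift_none.
have lift0 : lift ord_max ord0 = ord0 :> 'I_k.+2 by apply/val_inj; rewrite /= /bump leqn0.
rewrite /n_chains -sum1_card (partition_big last_proper (fun H => H \subset U)) /=; last first.
  move=> C; rewrite inE => /and3P[_ /eqP<- /forallP/(_ (lift ord_max ord_max))/forallP/(_ ord_max)].
  by move=> /implyP; apply; apply: leq_ord.
apply: eq_bigr => H HU; rewrite -sum1_card (reindex_onto snoc belast) /=; last first.
  move=> C; rewrite inE => /andP[/and3P[_ /eqP CU _] _]; apply/ffunP => i.
  by case: (unliftP ord_max i) => [j|] ->; rewrite ?snocl ?snocU ?ffunE.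
apply: eq_bigl => C.
have -> : belast (snoc C) = C by apply/ffunP => i; rewrite ffunE snocl.
rewrite eqxx andbT !inE snocU eqxx -lift0 snocl /last_proper snocl /=.
apply/andP/and3P => [[/andP[-> /forallP mono] ->]|[-> CH /forallP mono]]; split=> //.
  apply/forallP => i; apply/forallP => j; apply/implyP => ij.
  have := mono (lift ord_max i) => /forallP/(_ (lift ord_max j))/implyP.
  by rewrite !snocl; apply; rewrite !lift_max.
rewrite /=; apply/forallP => i; apply/forallP => j; apply/implyP.
case: (unliftP ord_max j) => [j' ->|->].
  case: (unliftP ord_max i) => [i' ->|->].
    by rewrite !snocl !lift_max => ij; apply: (implyP (forallP (mono i') j')).
  by rewrite lift_max /= leqNgt ltn_ord.
rewrite snocU; case: (unliftP ord_max i) => [i' ->|-> //] _; last by rewrite snocU.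
rewrite snocl; apply: (fintype.subset_trans _ HU); rewrite -(eqP CH).
by apply: (implyP (forallP (mono i') ord_max)); rewrite leq_ord.
Qed.

End Chains.

(** * Moments of products of random matrices *)

Section Moments.
Variables (R : realType) (V : finZmodType) (a : nat) (alpha : R).
Hypotheses (a_gt1 : (1 < a)%N) (Va : forall x : V, x *+ a = 0).
Hypotheses (alpha_gt0 : 0 < alpha) (alpha_le : alpha <= 1 / 2).
Implicit Types (U H : {group V}) (x : V).

(** The parameter [m] of [lift_estimate] may vary with [n]; [error_decay] selects it, with constants
    depending only on [V], [a] and [alpha]. *)
Lemma lift_uniform : exists K c : R, [/\ 0 < K, 0 < c &
  forall n (nu : 'I_n -> 'I_n -> 'Z_a -> R), (forall i j, balanced_weight alpha (nu i j)) ->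
  forall U (F' : {ffun 'I_n -> V}), F' \in maps_to n U ->
  `|\sum_(F in gens n U) \sum_(A | apply_mx F A == F') mx_weight nu A - 1|
    <= K * expR (- c * n%:R)].
Proof.
have N1 : 1 <= #|V|%:R :> R by rewrite ler1n; apply/card_gt0P; exists 0.
have N0 : 0 < #|V|%:R :> R by apply: lt_le_trans N1.
pose s := alpha / 2 / #|V|%:R.
have sN : s * #|V|%:R = alpha / 2 by rewrite divfK // gt_eqF.
have s0 : 0 < s by rewrite -(pmulr_lgt0 _ N0) sN divr_gt0.
have s1 : s <= 1.
  have h : s <= alpha / 2 by rewrite -sN; apply: ler_peMr => //; apply: ltW.
  by move: alpha_le => ?; lra.
have tP : 0 < 1 - alpha / 2 < 1 by move: alpha_le alpha_gt0 => *; apply/andP; split; lra.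
have sP : 0 < s <= 1 by rewrite s0.
have alpha_le1 : alpha <= 1 by move: alpha_le => ?; lra.
have [K [c [K0 c0 Kc]]] := error_decay #|V| #|{: {group V}}| tP
  (gamma_bounds V a_gt1 alpha_gt0 alpha_le1) sP.
exists K, c; split=> // n nu nuP U F' F'U; have [m le] := Kc n.
exact: le_trans (lift_estimate a_gt1 Va alpha_gt0 alpha_le m nuP sN F'U) le.
Qed.

(** As [a] kills [V], a multiple depends only on the residue of the multiplier, which makes [V] a
    module over ['Z_a]. *)
Let mulrn_modZp x m : x *+ (m %% (Zp_trunc a).+2) = x *+ m.
Proof.
by rewrite Zp_cast // [in RHS](divn_eq m a) mulrnDr mulnC mulrnA Va mul0rn add0r.
Qed.

Lemma mulrn_ZpD x (r s : 'Z_a) : x *+ (r + s)%R = x *+ r + x *+ s.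
Proof. by rewrite -mulrnDr /= mulrn_modZp. Qed.

Lemma mulrn_ZpM x (r s : 'Z_a) : x *+ (r * s)%R = x *+ r *+ s.
Proof. by rewrite -mulrnA /= mulrn_modZp. Qed.

Lemma mulrn_Zp_sum x (I : Type) (e : seq I) (P : pred I) (r : I -> 'Z_a) :
  x *+ (\sum_(i <- e | P i) r i)%R = \sum_(i <- e | P i) x *+ r i.
Proof. by apply: (big_morph (fun r : 'Z_a => x *+ r) (mulrn_ZpD x)). Qed.

Lemma apply_mx_mulmx n (F : {ffun 'I_n -> V}) (A B : 'M['Z_a]_n) :
  apply_mx (apply_mx F A) B = apply_mx F (A *m B).
Proof.
apply/ffunP => j; rewrite !ffunE.
under eq_bigr => i _ do rewrite ffunE -sumrMnl.
rewrite exchange_big /=; apply: eq_bigr => i _; rewrite mxE mulrn_Zp_sum.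
by apply: eq_bigr => l _; rewrite mulrn_ZpM.
Qed.

Lemma apply_mx_1mx n (F : {ffun 'I_n -> V}) : apply_mx F (1%:M : 'M['Z_a]_n) = F.
Proof.
apply/ffunP => j; rewrite ffunE (bigD1 j) //= big1 => [|i /negPf ij].
  by rewrite mxE eqxx addr0 /= modn_small.
by rewrite mxE ij.
Qed.

Lemma apply_mx_maps_to n U (F : {ffun 'I_n -> V}) (A : 'M['Z_a]_n) :
  F \in maps_to n U -> apply_mx F A \in maps_to n U.
Proof.
move=> /maps_toP FU; apply/maps_toP => j; rewrite ffunE.
by apply: (big_ind (fun x => x \in U)) => [|x y|i _];
  [apply: group1|apply: group_add|apply: group_mulrn].
Qed.

(** The probability that the product of the independent random matrices kills [F]. *)
Definition kill_weight n k (nu : 'I_k -> 'I_n -> 'I_n -> 'Z_a -> R) (F : {ffun 'I_n -> V}) : R :=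
  \sum_(A : {ffun 'I_k -> 'M['Z_a]_n} | apply_mx F (\prod_l A l) == [ffun=> 0])
    \prod_l mx_weight (nu l) (A l).

(** The expected number of generating tuples of [U] that are killed; for U = V this counts the
    surjections from the cokernel, by [card_Sur_Cok]. *)
Definition moment n k (nu : 'I_k -> 'I_n -> 'I_n -> 'Z_a -> R) U : R :=
  \sum_(F in gens n U) kill_weight nu F.

Lemma kill_weightS n k (nu : 'I_k.+1 -> 'I_n -> 'I_n -> 'Z_a -> R) F :
  kill_weight nu F =
  \sum_A mx_weight (nu ord0) A * kill_weight (fun l => nu (lift ord0 l)) (apply_mx F A).
Proof.
rewrite /kill_weight big_mkcond big_fcons; apply: eq_bigr => A _.
rewrite mulr_sumr [RHS]big_mkcond; apply: eq_bigr => B _.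
rewrite !big_ord_recl fcons0 apply_mx_mulmx.
have -> : \prod_(i < k) fcons A B (lift ord0 i) = \prod_i B i.
  by apply: eq_bigr => i _; rewrite fconsS.
case: ifP => // _; congr (_ * _).
by apply: eq_bigr => i _; rewrite fconsS.
Qed.

(** Condition on the first matrix, then sort the image tuple by the subgroup that it generates. *)
Lemma momentS n k (nu : 'I_k.+1 -> 'I_n -> 'I_n -> 'Z_a -> R) U :
  moment nu U =
  \sum_(H : {group V} | H \subset U) \sum_(F' in gens n H)
    (\sum_(F in gens n U) \sum_(A | apply_mx F A == F') mx_weight (nu ord0) A) *
    kill_weight (fun l => nu (lift ord0 l)) F'.
Proof.
set q := kill_weight _.
transitivity (\sum_(F' in maps_to n U)
    (\sum_(F in gens n U) \sum_(A | apply_mx F A == F') mx_weight (nu ord0) A) * q F').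
  under [RHS]eq_bigr => F' _ do rewrite mulr_suml.
  rewrite exchange_big; apply: eq_bigr => F FU /=.
  rewrite kill_weightS (partition_big (apply_mx F) (mem (maps_to n U))) /=; last first.
    by move=> A _; apply/apply_mx_maps_to/(fintype.subsetP (gens_maps_to n U)).
  by apply: eq_bigr => F' _; rewrite mulr_suml; apply: eq_bigr => A /eqP->.
rewrite (partition_big (fun F' : {ffun 'I_n -> V} => <<(F' @: [set: 'I_n])%SET>>%G)
   (fun H => H \subset U)) /=; last by move=> F'; apply: maps_to_generated.
apply: eq_bigr => H HU; apply: eq_bigl => F'.
apply/andP/idP => [[_ /eqP <-]|F'H]; first exact: gens_generated.
split.
  by apply/maps_toP => i; apply: (fintype.subsetP HU); apply: mem_gens F'H.
by apply/eqP/val_inj/eqP; move: F'H; rewrite inE.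
Qed.

Lemma kill_weight_ge0 n k (nu : 'I_k -> 'I_n -> 'I_n -> 'Z_a -> R) F :
  (forall l i j, balanced_weight alpha (nu l i j)) -> 0 <= kill_weight nu F.
Proof.
move=> nuP; apply: sumr_ge0 => A _; apply: prodr_ge0 => l _.
apply: prodr_ge0 => i _; apply: prodr_ge0 => j _.
by case: (nuP l i j) => -[].
Qed.

(** The empty product is the identity, so only the zero tuple is killed, and it generates the
    trivial group. *)
Lemma moment0 n (nu : 'I_0 -> 'I_n -> 'I_n -> 'Z_a -> R) U :
  moment nu U = (n_chains 0 U)%:R.
Proof.
have killE F : kill_weight nu F = (F == [ffun=> 0])%:R.
  rewrite /kill_weight big_mkcond (big_pred1 [ffun=> 0]) => [|A].
    by rewrite !big_ord0 apply_mx_1mx; case: eqP.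
  by apply/esym/eqP/ffunP; case.
have gens0 : ([ffun=> 0] \in gens n U) = (U == 1%G).
  rewrite inE; have -> : <<[ffun=> 0 : V] @: [set: 'I_n]>>%g = 1%G :> {set V}.
    apply/eqP; rewrite finset.eqEsubset sub1G andbT gen_subG.
    by apply/fintype.subsetP => _ /imsetP[i _ ->]; rewrite ffunE; apply: group1.
  by rewrite eq_sym; apply/eqP/eqP => [/val_inj|->].
rewrite n_chains0 -gens0 /moment; under eq_bigr => F _ do rewrite killE.
have [in0|out0] := boolP ([ffun=> 0] \in gens n U).
  rewrite (bigD1 [ffun=> 0]) //= eqxx big1 ?addr0 // => F /andP[_ /negPf].
  by move->.
rewrite big1 // => F FU; case: eqP => // F0.
by move: FU; rewrite F0 (negPf out0).
Qed.

Lemma moment_estimate k : exists K c : R, [/\ 0 < K, 0 < c &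
  forall n (nu : 'I_k -> 'I_n -> 'I_n -> 'Z_a -> R),
  (forall l i j, balanced_weight alpha (nu l i j)) ->
  forall U, `|moment nu U - (n_chains k U)%:R| <= K * expR (- c * n%:R)].
Proof.
have [K0 [c [K0_gt0 c_gt0 liftK0]]] := lift_uniform.
(* The rate [c] of the lifting estimate serves for every number of factors; only the constant
   grows. *)
suff [K [K_gt0 HK]] : exists K : R, 0 < K /\
  forall n (nu : 'I_k -> 'I_n -> 'I_n -> 'Z_a -> R),
  (forall l i j, balanced_weight alpha (nu l i j)) ->
  forall U, `|moment nu U - (n_chains k U)%:R| <= K * expR (- c * n%:R).
  by exists K, c.
elim: k => [|k [K [K_gt0 IH]]].
  exists 1; split=> // n nu _ U; rewrite moment0 subrr normr0.
  by rewrite mulr_ge0 ?expR_ge0.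
(* The first term is the lifting error times a bound for the moment with [k] factors, the second the
   inductive error. *)
pose C H : R := K0 * ((n_chains k H)%:R + K) + K.
have C_gt0 H : 0 < C H.
  by rewrite ltr_wpDl // mulr_ge0 ?addr_ge0 ?ler0n // ltW.
exists (\sum_H C H); split.
  rewrite (bigD1 1%G) //= ltr_wpDr //; apply: sumr_ge0 => H _; exact: ltW.
move=> n nu nuP U; set e := expR _.
have e_ge0 : 0 <= e by apply: expR_ge0.
have e_le1 : e <= 1.
  by rewrite /e -expR0 ler_expR mulNr oppr_le0 mulr_ge0 // ltW.
set nu' := fun l => nu (lift ord0 l).
rewrite momentS n_chainsS natr_sum -sumrB.
apply: le_trans (ler_norm_sum _ _ _) _; rewrite mulr_suml.
rewrite big_mkcond; apply: ler_sum => H _; case: ifP => [HU|_]; last first.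
  by rewrite mulr_ge0 // ltW.
have nu'P l i j : balanced_weight alpha (nu' l i j) by apply: nuP.
have IHH := IH n nu' nu'P H; rewrite -/e in IHH.
set W := fun F' : {ffun 'I_n -> V} =>
  \sum_(F in gens n U) \sum_(A | apply_mx F A == F') mx_weight (nu ord0) A.
rewrite -[X in `|X - _|]/(\sum_(F' in gens n H) W F' * kill_weight nu' F').
(* Replacing the weight [W F'] by 1 leaves exactly the moment of [H] for the remaining factors. *)
have -> : \sum_(F' in gens n H) W F' * kill_weight nu' F' - (n_chains k H)%:R =
    \sum_(F' in gens n H) (W F' - 1) * kill_weight nu' F' + (moment nu' H - (n_chains k H)%:R).
  rewrite addrA; congr (_ - _); rewrite /moment -big_split /=.
  by apply: eq_bigr => F' _; ring.
have le1 : `|\sum_(F' in gens n H) (W F' - 1) * kill_weight nu' F'| <= K0 * e * moment nu' H.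
  apply: le_trans (ler_norm_sum _ _ _) _; rewrite mulr_sumr; apply: ler_sum => F' F'H.
  rewrite normrM [`|kill_weight _ _|]ger0_norm ?kill_weight_ge0 //.
  apply: ler_wpM2r; first exact: kill_weight_ge0.
  apply: liftK0 => [i j|]; first exact: nuP.
  by apply/maps_toP => i; apply: (fintype.subsetP HU); apply: mem_gens F'H.
have le2 : moment nu' H <= (n_chains k H)%:R + K.
  rewrite -lerBlDl; apply: le_trans (ler_norm _) (le_trans IHH _).
  by rewrite ler_piMr // ltW.
have le3 : K0 * e * moment nu' H <= K0 * e * ((n_chains k H)%:R + K).
  by apply: ler_wpM2l le2; rewrite mulr_ge0 // ltW.
apply: le_trans (ler_normD _ _) _.
apply: le_trans (lerD (le_trans le1 le3) IHH) _.
by rewrite le_eqVlt /C; apply/orP; left; apply/eqP; ring.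
Qed.

End Moments.

(** * Cokernels *)

(** Images and preimages carry chains back and forth; this moves the count between [G] and its
    additive copy. *)
Lemma n_chains_injm (aT rT : finGroupType) (G : {group aT}) (f : {morphism G >-> rT}) (k : nat) :
  ('injm f)%g -> n_chains k (f @* G)%G = n_chains k G.
Proof.
move=> injf; pose im (C : {ffun 'I_k.+1 -> {group aT}}) : {ffun 'I_k.+1 -> {group rT}} :=
  [ffun i => (f @* C i)%G].
have chain_sub (gT : finGroupType) (U : {group gT}) (C : {ffun 'I_k.+1 -> {group gT}}) i :
    C \in nested_chains k U -> C i \subset U.
  rewrite inE => /and3P[_ /eqP<- /forallP/(_ i)/forallP/(_ ord_max)/implyP]; apply.
  exact: leq_ord.
rewrite /n_chains -(card_in_imset (f := im) (D := nested_chains k G)); last first.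
  move=> C D CG DG /ffunP e; apply/ffunP => i; have := e i; rewrite !ffunE => /(congr1 val) /= ei.
  by apply/val_inj/(injm_morphim_inj injf) => //; apply: chain_sub.
apply: eq_card => D; apply/idP/imsetP => [DG|[C CG ->]]; last first.
  move: (CG); rewrite inE => /and3P[/eqP C0 /eqP CG' /forallP mono].
  rewrite inE !ffunE C0 CG' eqxx /=; apply/andP; split.
    by apply/eqP/val_inj; rewrite /= morphim1.
  apply/forallP => i; apply/forallP => j; apply/implyP => ij; rewrite !ffunE.
  by apply: morphimS; apply: (implyP (forallP (mono i) j)).
exists [ffun i => (f @*^-1 D i)%G]; last first.
  apply/ffunP => i; rewrite !ffunE; apply/val_inj => /=.
  by rewrite morphpreK //; apply: chain_sub DG.
move: (DG); rewrite inE => /and3P[/eqP D0 /eqP DG' /forallP mono].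
rewrite inE !ffunE D0 DG'; apply/and3P; split.
- by apply/eqP/val_inj/trivgP.
- by apply/eqP/val_inj; rewrite /= morphimGK // finset.subsetIl.
- apply/forallP => i; apply/forallP => j; apply/implyP => ij; rewrite !ffunE.
  by apply: morphpreS; apply: (implyP (forallP (mono i) j)).
Qed.

Section Lin.
Variables (V : finZmodType) (a n : nat).
Hypotheses (a_gt1 : (1 < a)%N) (Va : forall x : V, x *+ a = 0).
Implicit Types (F : {ffun 'I_n -> V}) (u v : 'cV['Z_a]_n).

Definition lin F v : V := \sum_i F i *+ v i 0.

Lemma linD F : {morph lin F : u v / u + v}.
Proof.
move=> u v; rewrite /lin -big_split; apply: eq_bigr => i _.
by rewrite mxE mulrn_ZpD.
Qed.

Lemma lin0 F : lin F 0 = 0.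
Proof. by rewrite /lin big1 // => i _; rewrite mxE. Qed.

Lemma linN F : {morph lin F : u / - u}.
Proof. by move=> u; apply: (addrI (lin F u)); rewrite -linD !subrr lin0. Qed.

Lemma lin_delta F i : lin F (delta_mx i 0) = F i.
Proof.
rewrite /lin (bigD1 i) //= big1 => [|j /negPf ji]; last by rewrite mxE ji.
by rewrite mxE !eqxx addr0 /= modn_small.
Qed.

Lemma apply_mx_col F (A : 'M['Z_a]_n) j : apply_mx F A j = lin F (col j A).
Proof. by rewrite ffunE; apply: eq_bigr => i _; rewrite mxE. Qed.

Lemma lin_apply_mx F (A : 'M['Z_a]_n) v : lin F (A *m v) = lin (apply_mx F A) v.
Proof.
rewrite /lin; under [RHS]eq_bigr => j _ do rewrite ffunE -sumrMnl.
rewrite exchange_big /=; apply: eq_bigr => i _; rewrite mxE mulrn_Zp_sum //.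
by apply: eq_bigr => j _; rewrite mulrn_ZpM.
Qed.

(** Scalars in ['Z_a] act as natural multiples, so additivity already gives linearity. *)
Lemma additive_lin (g : 'cV['Z_a]_n -> V) v : {morph g : u v / u + v} ->
  g v = lin [ffun i => g (delta_mx i 0)] v.
Proof.
move=> gD; have g0 : g 0 = 0 by apply: (addrI (g 0)); rewrite -gD !addr0.
have gMn u m : g (u *+ m) = g u *+ m.
  by elim: m => // m IH; rewrite !mulrS gD IH.
rewrite [v in LHS]matrix_sum_delta (big_morph g gD g0); apply: eq_bigr => i _.
by rewrite big_ord1 -[X in X *: _]natr_Zp scaler_nat gMn ffunE.
Qed.

Lemma lin_image F : F \in gens n [set: V]%G -> forall x, exists v, x = lin F v.
Proof.
move=> FV x; pose im := [set lin F v | v in 'cV['Z_a]_n].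
have imG : group_set im.
  apply/group_setP; split; first by apply/imsetP; exists 0; rewrite ?lin0.
  by move=> _ _ /imsetP[u _ ->] /imsetP[v _ ->]; apply/imsetP; exists (u + v); rewrite ?linD.
have : <<F @: [set: 'I_n]>>%g \subset Group imG.
  rewrite gen_subG; apply/fintype.subsetP => _ /imsetP[i _ ->].
  by apply/imsetP; exists (delta_mx i 0); rewrite ?lin_delta.
move: FV; rewrite inE => /eqP-> /fintype.subsetP/(_ x); rewrite inE => /(_ isT).
by case/imsetP=> v _ ->; exists v.
Qed.

Lemma mem_lin_gen F v : lin F v \in <<F @: [set: 'I_n]>>%g.
Proof.
rewrite /lin; apply: (big_ind (fun x => x \in <<F @: [set: 'I_n]>>%g)) => [|x y|i _].
- exact: group1.
- exact: group_add.
- by apply: group_mulrn; apply: mem_gen; apply: imset_f; rewrite inE.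
Qed.

End Lin.

Section CokernelSurjections.
Variables (gT : finGroupType) (G : {group gT}) (a n : nat).
Hypotheses (a_gt1 : (1 < a)%N) (abG : abelian G) (expG : (exponent G %| a)%N).
Variable A : 'M['Z_a]_n.
(** The additive copy of [G], to which the estimates above apply. *)
Local Notation V := (FiniteModule.fmod_of abG).
Local Notation H := (colspace A).

Lemma fmod_exponent (x : V) : x *+ a = 0.
Proof.
apply: val_inj; rewrite FiniteModule.fmvalZ FiniteModule.fmval0.
by apply/(exponentP expG); apply: FiniteModule.fmodP.
Qed.
Let Va := fmod_exponent.

Let normH v : v \in 'N(H)%g.
Proof. by apply/(fintype.subsetP (cent_sub H))/centP => y _; apply: FinRing.zmod_mulgC. Qed.

Let cosetK (c : coset_of H) : coset H (repr c) = c. Proof. exact: coset_reprK. Qed.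

Let mem_Cok c : c \in Cok A.
Proof. by rewrite -(cosetK c); apply: mem_quotient; rewrite inE. Qed.

(** Evaluated at chosen representatives; [Sur_of_coset] shows independence of the choice once [F]
    kills the columns of [A]. *)
Definition Sur_of (F : {ffun 'I_n -> V}) : {ffun coset_of H -> gT} :=
  [ffun c : coset_of H => FiniteModule.fmval (lin F (repr c))].

Lemma Sur_of_coset F v : apply_mx F A = [ffun=> 0] ->
  Sur_of F (coset H v) = FiniteModule.fmval (lin F v).
Proof.
move=> FA; rewrite ffunE; congr FiniteModule.fmval.
have /rcoset_kercosetP : coset H (repr (coset H v)) = coset H v by apply: cosetK.
move=> /(_ (normH _) (normH _)); rewrite mem_rcoset => /imsetP[u _ e].
have {}e : repr (coset H v) - v = A *m u by [].
apply/eqP; rewrite -subr_eq0 -linN // -linD // e lin_apply_mx // FA.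
by apply/eqP; rewrite /lin big1 // => i _; rewrite ffunE mul0rn.
Qed.

(** [Sur_of] is a bijection: the values at the basis vectors recover [F], and a surjection composed
    with the quotient map is linear, kills the columns of [A] and reaches all of [V]. *)
Lemma card_Sur_Cok :
  #|Sur (Cok A) G| = #|[set F in gens n [set: V]%G | apply_mx F A == [ffun=> 0]]|.
Proof.
rewrite -(card_in_imset (f := Sur_of)); last first.
  move=> F F'; rewrite !inE => /andP[_ /eqP FA] /andP[_ /eqP FA'] e.
  apply/ffunP => i; apply: (@FiniteModule.fmod_inj _ _ abG).
  by rewrite -[F i](lin_delta a) -[F' i](lin_delta a) -!Sur_of_coset // e.
apply: eq_card => f; apply/idP/imsetP => [|[F]]; last first.
  rewrite inE => /andP[Fgen /eqP FA] ->; rewrite inE; apply/and3P; split.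
  - by apply/fintype.subsetP => c _; apply: mem_Cok.
  - apply/morphicP => c c' _ _; rewrite -[c]cosetK -[c']cosetK -morphM //.
    by rewrite !Sur_of_coset // -FiniteModule.fmvalA -linD.
  - apply/eqP/setP => x; apply/imsetP/idP => [[c _ ->]|xG].
      by rewrite ffunE; apply: FiniteModule.fmodP.
    have [v e] := lin_image a_gt1 Va Fgen (FiniteModule.fmod abG x).
    exists (coset H v); first exact: mem_Cok.
    by rewrite Sur_of_coset // -e; apply/esym; apply: FiniteModule.fmodK.
rewrite inE => /and3P[_ /morphicP fM /eqP fim].
have fG c : f c \in G by rewrite -fim imset_f.
pose g v : V := FiniteModule.fmod abG (f (coset H v)).
have gD : {morph g : u v / u + v}.
  by move=> u v; rewrite /g -FiniteModule.fmodM // -fM // -morphM.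
set F := [ffun i => g (delta_mx i 0)].
have gF v : g v = lin F v by apply: additive_lin.
have gH v : v \in H -> g v = 0.
  move=> vH; apply: (addrI (g 0)); rewrite -gD addr0 add0r.
  by rewrite /g coset_id // coset_id // group1.
have FA : apply_mx F A = [ffun=> 0].
  apply/ffunP => j; rewrite apply_mx_col -gF ffunE; apply: gH.
  by apply/imsetP; exists (delta_mx j 0); rewrite ?inE // colE.
exists F; last first.
  apply/ffunP => c; rewrite -[c]cosetK Sur_of_coset // -gF.
  by apply/esym; apply: FiniteModule.fmodK.
rewrite inE FA eqxx andbT inE finset.eqEsubset finset.subsetT /=.
apply/fintype.subsetP => x _; have /imsetP[c _ e] : FiniteModule.fmval x \in f @: Cok A.
  by rewrite fim FiniteModule.fmodP.
have -> : x = lin F (repr c) by rewrite -gF /g cosetK -e FiniteModule.fmvalK.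
exact: mem_lin_gen.
Qed.

Lemma n_chains_fmod k : n_chains k [set: V]%G = n_chains k G.
Proof.
rewrite -(n_chains_injm k (FiniteModule.injm_fmod abG)); congr n_chains.
apply/val_inj/eqP; rewrite /= eq_sym finset.eqEsubset finset.subsetT /=.
apply/fintype.subsetP => x _; apply/morphimP; exists (FiniteModule.fmval x).
- exact: FiniteModule.fmodP.
- exact: FiniteModule.fmodP.
- by apply: FiniteModule.fmod_inj; rewrite -[RHS]/(val _) FiniteModule.fmodK // FiniteModule.fmodP.
Qed.

End CokernelSurjections.

(** * Random elements of finite sets *)

Local Open Scope classical_set_scope.

Section FiniteRandomElements.
Context {d : measure_display} {T : measurableType d} {R : realType}.
Variable P : probability T R.

(** The integrand is a finite combination of indicators of the fibres of [Y]. *)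
Lemma integral_finite_range (E : finType) (Y : T -> E) (g : E -> R) :
  discrete_random Y -> (forall y, 0 <= g y) ->
  (\int[P]_w (g (Y w))%:E = (\sum_y g y * fine (P (Y @^-1` [set y])))%:E)%E.
Proof.
move=> mY g0.
have -> : (fun w => (g (Y w))%:E) =
    (fun w => \sum_(y <- index_enum E) (g y * \1_(Y @^-1` [set y]) w)%:E)%E.
  apply/funext => w; rewrite sumEFin (bigD1 (Y w)) //= big1 ?addr0.
    by rewrite indicE mem_set // mulr1.
  by move=> y yY; rewrite indicE memNset ?mulr0 //= => e; rewrite e eqxx in yY.
rewrite ge0_integral_sum //.
- rewrite -sumEFin; apply: eq_bigr => y _.
  rewrite (integralZl_indic _ (fun=> Y @^-1` [set y])) //; last by move=> /lt_geF; rewrite g0.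
  by rewrite integral_indic // setIT EFinM fineK // fin_num_measure.
- move=> y; apply/measurable_EFinP; exact: measurable_funM.
- by move=> y w _; rewrite lee_fin mulr_ge0.
Qed.

Lemma prob_finite_range (E : finType) (Y : T -> E) (Q : pred E) :
  discrete_random Y ->
  P [set w | Q (Y w)] = (\sum_(y | Q y) fine (P (Y @^-1` [set y])))%:E.
Proof.
move=> mY; have := integral_finite_range mY (fun y => ler0n R (Q y)).
under eq_bigr => y _ do rewrite mulr_natl mulrb.
rewrite -big_mkcond => <-.
rewrite -[X in P X]setIT -integral_indic //; last exact: (mY [set y | Q y]).
apply: eq_integral => w _; congr EFin; rewrite indicE; congr (_%:R); congr nat_of_bool.
by apply/idP/idP => [/set_mem|] //; apply: mem_set.
Qed.

Lemma discrete_random_comp (E E' : Type) (Y : T -> E) (h : E -> E') :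
  discrete_random Y -> discrete_random (h \o Y).
Proof. by move=> mY A; rewrite comp_preimage; apply: mY. Qed.

Lemma discrete_random_ffun (I E : finType) (Y : I -> T -> E) :
  (forall i, discrete_random (Y i)) -> discrete_random (fun w => [ffun i => Y i w]).
Proof.
move=> mY A.
have -> : (fun w => [ffun i => Y i w]) @^-1` A =
    \bigcup_(f in A) \bigcap_(i in [set: I]) (Y i @^-1` [set f i]).
  apply/seteqP; split => [w Aw|w [f Af fw]] /=.
    by exists [ffun i => Y i w] => // i _ /=; rewrite ffunE.
  rewrite (_ : [ffun i => Y i w] = f) //.
  by apply/ffunP => i; rewrite ffunE; apply: fw.
apply: fin_bigcup_measurable => [|f _]; first exact: finite_finset.
by apply: fin_bigcap_measurable => // i _; apply: mY.
Qed.

Definition pmf (E : Type) (Y : T -> E) (y : E) : R := fine (P (Y @^-1` [set y])).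

Lemma pmf_ge0 (E : Type) (Y : T -> E) y : 0 <= pmf Y y.
Proof. by rewrite fine_ge0. Qed.

(** Independence applied to the full index set and singleton events. *)
Lemma pmf_ffun (I E : finType) (Y : I -> T -> E) (f : {ffun I -> E}) :
  (forall i, discrete_random (Y i)) -> mutually_independent P Y ->
  pmf (fun w => [ffun i => Y i w]) f = \prod_i pmf (Y i) (f i).
Proof.
move=> mY indY; have := indY [set: I]%SET (fun i => [set f i]).
have -> : [set w | forall i, i \in [set: I]%SET -> [set f i] (Y i w)] =
    (fun w => [ffun i => Y i w]) @^-1` [set f].
  apply/seteqP; split => w /= h; last by move=> i _; rewrite -h ffunE.
  by apply/ffunP => i; rewrite ffunE; apply: h; rewrite inE.
rewrite /pmf => ->.
rewrite (eq_bigr (fun i => (pmf (Y i) (f i))%:E)) => [|i _]; last first.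
  by rewrite /pmf fineK // fin_num_measure //; apply: mY.
by rewrite prodEFin; apply: eq_bigl => i; rewrite inE.
Qed.

Lemma pmf_mx (a n : nat) (M : T -> 'M['Z_a]_n) (A : 'M['Z_a]_n) :
  discrete_random M -> mutually_independent P (entry M) ->
  pmf M A = mx_weight (fun i j => pmf (entry M (i, j))) A.
Proof.
move=> mM indM; rewrite /mx_weight pair_bigA /=.
have mE ij : discrete_random (entry M ij).
  exact: (discrete_random_comp (fun B : 'M['Z_a]_n => B ij.1 ij.2)).
transitivity (pmf (fun w => [ffun ij => entry M ij w]) [ffun ij => A ij.1 ij.2]).
  congr (fine (P _)); apply/seteqP; split => w /= e.
    by apply/ffunP => ij; rewrite !ffunE -e.
  apply/matrixP => i j; move/ffunP: e => /(_ (i, j)).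
  by rewrite !ffunE.
rewrite pmf_ffun //; apply: eq_bigr => -[i j] _.
by rewrite ffunE.
Qed.

Lemma pmf_balanced (a : nat) (alpha : R) (xi : T -> 'Z_a) :
  discrete_random xi -> balanced P alpha xi -> balanced_weight alpha (pmf xi).
Proof.
move=> mxi bal; split; first split; first by move=> r; apply: pmf_ge0.
  have := prob_finite_range predT mxi; rewrite (_ : [set w | _] = setT).
    by rewrite probability_setT => -[].
  by apply/seteqP; split.
(* [balanced] speaks of residues in ['I_p], [balanced_weight] of any natural number, so [r] is
   reduced first. *)
move=> p r p_pr p_a; have rp : (r %% p < p)%N by rewrite ltn_mod prime_gt0.
have := bal p p_pr p_a (Ordinal rp).
have := prob_finite_range (fun s : 'Z_a => s == r %[mod p]) mxi.
rewrite (_ : [set w | _] = [set w | (xi w : nat) = Ordinal rp %[mod p]]).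
  by move=> ->; rewrite lee_fin.
by apply/seteqP; split => w /=; rewrite modn_mod => /eqP.
Qed.

End FiniteRandomElements.


(** * Expected number of surjections from the random cokernel *)

Theorem theorem3p2 (R : realType) (k a : nat) (alpha : R)
    (gT : finGroupType) (G : {group gT}) :
  (1 <= k)%N -> (2 <= a)%N -> 0 < alpha <= 1 / 2 ->
  abelian G -> (exponent G %| a)%N ->
  exists K c : R, [/\ 0 < K, 0 < c &
    forall (n : nat) (d : measure_display) (T : measurableType d)
      (P : probability T R) (M : 'I_k -> T -> 'M['Z_a]_n),
    (1 <= n)%N ->
    (forall l, discrete_random (M l)) ->
    mutually_independent P M ->
    (forall l, iid_balanced_entries P alpha (M l)) ->
    (`| 'E_P[fun w => #|Sur (Cok (\prod_(l < k) M l w)) G|%:R]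
        - (n_chains k G)%:R%:E |
      <= (K * expR (- c * n%:R))%:E)%E].
Proof.
move=> _ a_gt1 /andP[alpha_gt0 alpha_le] abG expG.
have Va := fmod_exponent (abG := abG) expG.
have [K [c [K_gt0 c_gt0 HK]]] := moment_estimate a_gt1 Va alpha_gt0 alpha_le k.
exists K, c; split=> // n d T P M _ mM indM iidM.
pose nu l i j : 'Z_a -> R := pmf P (entry (M l) (i, j)).
have nuP l i j : balanced_weight alpha (nu l i j).
  apply: pmf_balanced; last by case: (iidM l) => _ _; apply.
  exact: (discrete_random_comp (fun B : 'M['Z_a]_n => B i j)).
pose Y w := [ffun l => M l w].
pose surj (A : {ffun 'I_k -> 'M['Z_a]_n}) : R := #|Sur (Cok (\prod_l A l)) G|%:R.
(* Expands the expectation over the values of the matrices, counts surjections as killed generating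
   tuples, and exchanges the two sums. *)
have -> : ('E_P[fun w => #|Sur (Cok (\prod_(l < k) M l w)) G|%:R] =
    (moment nu [set: FiniteModule.fmod_of abG]%G)%:E)%E.
  rewrite unlock; transitivity (\int[P]_w (surj (Y w))%:E)%E.
    apply: eq_integral => w _; rewrite /surj; congr ((#|Sur (Cok _) G|%:R)%:E).
    by apply: eq_bigr => l _; rewrite ffunE.
  rewrite integral_finite_range; first last.
  - by move=> A; apply: ler0n.
  - exact: discrete_random_ffun.
  congr EFin; rewrite /moment.
  under [RHS]eq_bigr => F _ do rewrite /kill_weight big_mkcond.
  rewrite exchange_big; apply: eq_bigr => A _ /=.
  have -> : fine (P (Y @^-1` [set A])) = \prod_l mx_weight (nu l) (A l).
    rewrite -/(pmf P Y A) pmf_ffun //; apply: eq_bigr => l _.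
    by rewrite pmf_mx //; case: (iidM l).
  rewrite /surj (card_Sur_Cok a_gt1 abG expG) -sum1_card natr_sum mulr_suml.
  rewrite big_mkcond [RHS]big_mkcond /=.
  apply: eq_bigr => F _; rewrite finset.inE; case: (F \in _) => //=.
  by case: ifP; rewrite ?mul1r.
rewrite -(n_chains_fmod abG) -EFinB abse_EFin lee_fin; exact: HK.
Qed.
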